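(* (Denotational preciseness.) Fix a linear channel $a$ and, for $*\in\{s,a\}$, let $[\![T]\!]_*=\{P\mid \emptyset\vdash_* P\triangleright\{a:T\}\}$. Then for all closed session types $T,S$: $T\le_s S$ if and only if $[\![T]\!]_s\subseteq[\![S]\!]_s$; and $T\le_a S$ if and only if $[\![T]\!]_a\subseteq[\![S]\!]_a$.
   Context: Processes. Channel variables $x,y,\ldots$, linear channels $a,b,c,d,\ldots$, labels $l$, process variables $X$; identifiers $u ::= a\mid x$. Synchronous processes: $P ::= \mathbf 0 \mid X\langle\tilde u\rangle \mid \sum_{i\in I} u?l_i(x_i).P_i \mid u!l\langle u'\rangle.P \mid P|P \mid P\oplus P \mid \mathbf{def}\ X(\tilde x)=P\ \mathbf{in}\ P \mid (\nu ab)P \mid \mathtt{error}$ (labels in inputs pairwise distinct, guarded recursion, $(\nu ab)$ binds co-channels $a,b$); asynchronous processes additionally include queues $\langle a\to b:h\rangle$, $h ::= \varnothing\mid l\langle a\rangle\mid h\cdot h$ ($a$ enqueues, $b$ dequeues). Session types $T,S ::= \&_{i\in I}?l_i(S_i).T_i\mid\bigoplus_{i\in I}!l_i\langle S_i\rangle.T_i\mid\mathbf t\mid\mu\mathbf t.T\mid\mathsf{end}$ (distinct labels, closed exchanged types, contractive, equi-recursive: types with the same regular tree are identified); duality $\overline T$ swaps $\&?$ and $\oplus!$ along continuations keeping exchanged types, $\overline{\mathbf t}=\mathbf t$, $\overline{\mu\mathbf t.T}=\mu\mathbf t.\overline T$, $\overline{\mathsf{end}}=\mathsf{end}$. Synchronous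 subtyping $\le_s$: largest relation on closed types such that $T\le_s S$ implies one of: $T=S=\mathsf{end}$; $T=\&_{i\in I\cup J}?l_i(S_i).T_i$, $S=\&_{i\in I}?l_i(S'_i).T'_i$, $S_i\le_s S'_i$, $T_i\le_s T'_i$ ($i\in I$); $T=\bigoplus_{i\in I}!l_i\langle S_i\rangle.T_i$, $S=\bigoplus_{i\in I\cup J}!l_i\langle S'_i\rangle.T'_i$, $S'_i\le_s S_i$, $T_i\le_s T'_i$ ($i\in I$). Asynchronous contexts $\mathcal A ::= [\,]^n\mid\&_{i\in I}?l_i(S_i).\mathcal A_i$ (indexed holes; $\mathcal A[T_n]^{n\in N}$ fills hole $n$ with $T_n$; $\&\in\mathcal A$ iff $\mathcal A$ is not a single hole). $\&\in T$ inductively: $\&\in\&_i\ldots$; $\&\in\bigoplus_{i}!l_i\langle S_i\rangle.T_i$ if $\&\in T_i$ for all $i$; $\&\in\mu\mathbf t.T$ if $\&\in T$. Asynchronous subtyping $\le_a$: largest relation such that $T\le_a S$ implies one of the three cases of $\le_s$ (with $\le_a$ in the premises), or $T=\bigoplus_{i\in I}!l_i\langle S_i\rangle.T_i$, $S=\mathcal A[\bigoplus_{i\in I\cup J_n}!l_i\langle S^n_i\rangle.T^n_i]^{n\in N}$, $\&\in\mathcal A$, and for all $i\in I,n\in N$: $S^n_i\le_a S_i$, $T_i\le_a\mathcal A[T^n_i]^{n\in N}$, $\&\in T_i$. Synchronous typing $\Gamma\vdash_s P\triangleright\Delta$ ($\Gamma ::= \emptyset\mid\Gamma,X:\tilde T$;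 $\Delta ::= \emptyset\mid\Delta,u:T$; $\Delta_1\le_s\Delta_2$ means $\Delta_1(u)\le_s\Delta_2(u)$ on the common domain and $\mathsf{end}$ elsewhere): subsumption along $\le_s$; $\Gamma\vdash_s\mathbf 0\triangleright\emptyset$; $\Gamma,X:\tilde T\vdash_s X\langle\tilde u\rangle\triangleright\{\tilde u:\tilde T\}$; from $\Gamma\vdash_s P_i\triangleright\Delta,u:T_i,x_i:S_i$ ($i\in I$) infer $\Gamma\vdash_s\sum_i u?l_i(x_i).P_i\triangleright\Delta,u:\&_i?l_i(S_i).T_i$; from $\Gamma\vdash_s P\triangleright\Delta,u:T$ infer $\Gamma\vdash_s u!l\langle u'\rangle.P\triangleright\Delta,u:!l\langle S\rangle.T,u':S$; parallel: disjoint union of environments; choice: same environment; from $\Gamma,X:\tilde T\vdash_s P\triangleright\{\tilde x:\tilde T\}$ and $\Gamma,X:\tilde T\vdash_s Q\triangleright\Delta$ infer $\Gamma\vdash_s\mathbf{def}\ X(\tilde x)=P\ \mathbf{in}\ Q\triangleright\Delta$; from $\Gamma\vdash_s P\triangleright\Delta,a:T,b:\overline T$ infer $\Gamma\vdash_s(\nu ab)P\triangleright\Delta$. No rule types $\mathtt{error}$. Asynchronous typing $\Gamma\vdash_a P\triangleright\Delta$: queue types $\tau ::= \epsilon\mid l\langle S\rangle\mid\tau\cdot\tau$; environments additionally contain entries $ab:\tau$ typing queues $\langle a\to b:\cdot\rangle$ (composition requires disjoint identifier and queue domains; $\Delta_1\le_a\Delta_2$ as for $\le_s$ with $\le_a$,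 plus identical queue domains and queue types). Remainder (partial): $T\ominus\epsilon=T$; $(\&_{i\in I}?l_i(S_i).T_i)\ominus(l_k\langle S\rangle\cdot\tau)=T_k\ominus\tau$ if $k\in I$ and $S_k\le_a S$; $(\bigoplus_i!l_i\langle S_i\rangle.T_i)\ominus\tau=\bigoplus_i!l_i\langle S_i\rangle.(T_i\ominus\tau)$. Rules: those of $\vdash_s$ with $\le_a$ in subsumption and without the restriction rule, plus: from $\Gamma\vdash_a P\triangleright\Delta,a:T_1,b:T_2,ba:\tau_1,ab:\tau_2$ with $T_2\ominus\tau_2=\overline{T_1\ominus\tau_1}$ infer $\Gamma\vdash_a(\nu ab)P\triangleright\Delta$; $\Gamma\vdash_a\langle b\to a:\varnothing\rangle\triangleright\{ba:\epsilon\}$; from $\Gamma\vdash_a\langle b\to a:h\rangle\triangleright\Delta,ba:\tau$ infer $\Gamma\vdash_a\langle b\to a:h\cdot l\langle c\rangle\rangle\triangleright\Delta,c:S,ba:\tau\cdot l\langle S\rangle$. $[\![T]\!]_s$ ranges over synchronous processes and $[\![T]\!]_a$ over asynchronous processes. *)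

(* Defs.v *)
From HB Require Import structures.
From mathcomp Require Import all_boot finmap.
From Stdlib Require List.

Set Implicit Arguments.
Unset Strict Implicit.
Unset Printing Implicit Defensive.

Local Open Scope fset_scope.
Local Open Scope fmap_scope.

Notation label := nat (only parsing).
Notation chan := nat (only parsing).
Notation var := nat (only parsing).
Notation pvar := nat (only parsing).

(* Type variables are de Bruijn indices.  A branch (l, (S, T)) of [TIn]
   (resp. [TOut]) is the summand ?l(S).T (resp. !l<S>.T). *)
Inductive sty : Type :=
| TEnd
| TVar (k : nat)
| TMu (T : sty)
| TIn (bs : seq (label * (sty * sty)))
| TOut (bs : seq (label * (sty * sty))).

Notation branch := (label * (sty * sty))%type (only parsing).

(* Variable k is not at the head of T: T is not mu ... mu. k *)
Fixpoint guarded (k : nat) (T : sty) : bool :=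
  match T with
  | TVar j => j != k
  | TMu T' => guarded k.+1 T'
  | _ => true
  end.

(* [wf_at n T]: the free variables of T are among 0, ..., n - 1, exchanged types
   are closed, and T is contractive.  Choices have a nonempty index set. *)
Fixpoint wf_at (n : nat) (T : sty) : bool :=
  match T with
  | TEnd => true
  | TVar k => k < n
  | TMu T' => guarded 0 T' && wf_at n.+1 T'
  | TIn bs | TOut bs =>
      [&& ~~ nilp bs, uniq (map fst bs)
        & all (fun b => let: (_, (U, T')) := b in wf_at 0 U && wf_at n T') bs]
  end.

Definition wf (T : sty) : bool := wf_at 0 T.

(* Only used with U the closed type mu.T being unfolded, so that neither lifting
   nor decrementing is needed; exchanged types are closed, hence untouched. *)
Fixpoint tsubst (k : nat) (U T : sty) : sty :=
  match T with
  | TEnd => TEnd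
  | TVar j => if j == k then U else TVar j
  | TMu T' => TMu (tsubst k.+1 U T')
  | TIn bs =>
      TIn (map (fun b => let: (l, (V, T')) := b in (l, (V, tsubst k U T'))) bs)
  | TOut bs =>
      TOut (map (fun b => let: (l, (V, T')) := b in (l, (V, tsubst k U T'))) bs)
  end.

Definition unfold1 (T : sty) : sty :=
  if T is TMu T' then tsubst 0 T T' else T.

Fixpoint mu_height (T : sty) : nat :=
  if T is TMu T' then (mu_height T').+1 else 0.

(* Unfolds all leading mu's: by contractiveness each unfolding of a closed type
   decreases [mu_height], so [unf T] exposes the root of the tree of T. *)
Definition unf (T : sty) : sty := iter (mu_height T) unfold1 T.

Fixpoint dual (T : sty) : sty :=
  match T with
  | TEnd => TEnd
  | TVar k => TVar k
  | TMu T' => TMu (dual T')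
  | TIn bs => TOut (map (fun b => let: (l, (U, T')) := b in (l, (U, dual T'))) bs)
  | TOut bs => TIn (map (fun b => let: (l, (U, T')) := b in (l, (U, dual T'))) bs)
  end.

(* The largest relation on closed types such that R T S implies F R T S
   (every F below is monotone). *)
Definition largest (F : (sty -> sty -> Prop) -> sty -> sty -> Prop)
    (T S : sty) : Prop :=
  exists R : sty -> sty -> Prop,
    (forall T' S', R T' S' -> [/\ wf T', wf S' & F R T' S']) /\ R T S.

(* Equality of the regular trees of closed types.  Branches are indexed by
   their labels, so their order in the lists is irrelevant. *)
Definition branches_eq (R : sty -> sty -> Prop) (bs bs' : seq branch) : Prop :=
  (forall l S T, List.In (l, (S, T)) bs ->
     exists S' T', [/\ List.In (l, (S', T')) bs', R S S' & R T T']) /\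
  (forall l S' T', List.In (l, (S', T')) bs' ->
     exists S T, [/\ List.In (l, (S, T)) bs, R S S' & R T T']).

Variant teq_step (R : sty -> sty -> Prop) (T T' : sty) : Prop :=
| TeqEnd of unf T = TEnd & unf T' = TEnd
| TeqIn bs bs' of unf T = TIn bs & unf T' = TIn bs' & branches_eq R bs bs'
| TeqOut bs bs' of unf T = TOut bs & unf T' = TOut bs' & branches_eq R bs bs'.

Definition teq : sty -> sty -> Prop := largest teq_step.

Variant le_s_step (R : sty -> sty -> Prop) (T S : sty) : Prop :=
| LeEnd of unf T = TEnd & unf S = TEnd
| LeIn bs bs' of unf T = TIn bs & unf S = TIn bs' &
    (forall l S' T', List.In (l, (S', T')) bs' ->
       exists S0 T0, [/\ List.In (l, (S0, T0)) bs, R S0 S' & R T0 T'])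
| LeOut bs bs' of unf T = TOut bs & unf S = TOut bs' &
    (forall l S0 T0, List.In (l, (S0, T0)) bs ->
       exists S' T', [/\ List.In (l, (S', T')) bs', R S' S0 & R T0 T']).

Definition le_s : sty -> sty -> Prop := largest le_s_step.

Inductive actx : Type :=
| AHole (n : nat)
| AIn (bs : seq (label * (sty * actx))).

Fixpoint fill (A : actx) (f : nat -> sty) : sty :=
  match A with
  | AHole n => f n
  | AIn bs => TIn (map (fun b => let: (l, (U, A')) := b in (l, (U, fill A' f))) bs)
  end.

Fixpoint holes (A : actx) : seq nat :=
  match A with
  | AHole n => [:: n]
  | AIn bs => flatten (map (fun b => let: (_, (_, A')) := b in holes A') bs)
  end.

Definition in_actx (A : actx) : bool := if A is AHole _ then false else true.

Inductive has_in : sty -> Prop :=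
| HasIn bs : has_in (TIn bs)
| HasOut bs : (forall l S T, List.In (l, (S, T)) bs -> has_in T) ->
    has_in (TOut bs)
| HasMu T : has_in T -> has_in (TMu T).

(* In [LeAsync], hole n of A is filled by the selection with branches [cs n];
   for the branch of T labelled l, hole n offers the branch !l<Sn n>.(Tn n).
   The decomposition of S is taken up to tree equality. *)
Variant le_a_step (R : sty -> sty -> Prop) (T S : sty) : Prop :=
| LeSync of le_s_step R T S
| LeAsync bs A (cs : nat -> seq branch) of
    unf T = TOut bs &
    teq S (fill A (fun n => TOut (cs n))) &
    in_actx A &
    (forall l S0 T0, List.In (l, (S0, T0)) bs ->
       has_in T0 /\
       exists Sn Tn : nat -> sty,
         (forall n, n \in holes A ->
            List.In (l, (Sn n, Tn n)) (cs n) /\ R (Sn n) S0) /\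
         R T0 (fill A Tn)).

Definition le_a : sty -> sty -> Prop := largest le_a_step.

Inductive ident : Type := Chan (a : chan) | Var (x : var).

Definition ident_code (u : ident) : nat + nat :=
  match u with Chan a => inl a | Var x => inr x end.
Definition ident_decode (c : nat + nat) : ident :=
  match c with inl a => Chan a | inr x => Var x end.
Lemma ident_codeK : cancel ident_code ident_decode.
Proof. by case. Qed.
HB.instance Definition _ := Choice.copy ident (can_type ident_codeK).

(* Named syntax.  [PRes a b P] is (nu a b)P; [PQueue a b h] is <a -> b : h>,
   where h is a sequence of messages l<c>: queues are the free monoid on
   messages, the head of the list being the first message to be dequeued. *)
Inductive proc : Type :=
| PNil
| PCall (X : pvar) (us : seq ident)
| PIn (u : ident) (bs : seq (label * (var * proc)))
| POut (u : ident) (l : label) (u' : ident) (P : proc)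
| PPar (P Q : proc)
| PChoice (P Q : proc)
| PDef (X : pvar) (xs : seq var) (P Q : proc)
| PRes (a b : chan) (P : proc)
| PError
| PQueue (a b : chan) (h : seq (label * chan)).

(* Every free occurrence of X in P is under an input or output prefix. *)
Fixpoint guarded_in (X : pvar) (P : proc) : bool :=
  match P with
  | PCall Y _ => Y != X
  | PPar P1 P2 | PChoice P1 P2 => guarded_in X P1 && guarded_in X P2
  | PDef Y _ P1 P2 => (Y == X) || (guarded_in X P1 && guarded_in X P2)
  | PRes _ _ P1 => guarded_in X P1
  | _ => true
  end.

Fixpoint wf_proc (P : proc) : bool :=
  match P with
  | PIn _ bs =>
      [&& ~~ nilp bs, uniq (map fst bs)
        & all (fun b => let: (_, (_, P')) := b in wf_proc P') bs]
  | POut _ _ _ P1 | PRes _ _ P1 => wf_proc P1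
  | PPar P1 P2 | PChoice P1 P2 => wf_proc P1 && wf_proc P2
  | PDef X _ P1 P2 => [&& guarded_in X P1, wf_proc P1 & wf_proc P2]
  | _ => true
  end.

(* The synchronous processes are those without queues. *)
Fixpoint sync_proc (P : proc) : bool :=
  match P with
  | PIn _ bs => all (fun b => let: (_, (_, P')) := b in sync_proc P') bs
  | POut _ _ _ P1 | PRes _ _ P1 => sync_proc P1
  | PPar P1 P2 | PChoice P1 P2 | PDef _ _ P1 P2 => sync_proc P1 && sync_proc P2
  | PQueue _ _ _ => false
  | _ => true
  end.

Definition genv := {fmap pvar -> seq sty}.
Definition env := {fmap ident -> sty}.
Notation qtype := (seq (label * sty)) (only parsing).
Definition qenv := {fmap (chan * chan) -> qtype}.

Definition env0 : env := [fmap].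
Definition genv0 : genv := [fmap].
Definition qenv0 : qenv := [fmap].

Definition env_of (us : seq ident) (Ts : seq sty) : env :=
  foldr (fun p (D : env) => D.[p.1 <- p.2]) env0 (zip us Ts).

Definition env_le (le : sty -> sty -> Prop) (D1 D2 : env) : Prop :=
  forall u : ident,
    match D1.[? u], D2.[? u] with
    | Some T1, Some T2 => le T1 T2
    | Some T, None | None, Some T => teq T TEnd
    | None, None => True
    end.

(* Equality of queue environments, types being identified by [teq]. *)
Definition qenv_eq (Q1 Q2 : qenv) : Prop :=
  forall p : chan * chan,
    match Q1.[? p], Q2.[? p] with
    | Some t1, Some t2 =>
        List.Forall2 (fun m1 m2 => m1.1 = m2.1 /\ teq m1.2 m2.2) t1 t2
    | None, None => True
    | _, _ => False
    end.

(* [D.[u <- T]] renders "D, u : T", with the condition that u is not in the domain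
   of D as a separate premise; bound names are thus distinct from the names of
   the environment.  [G.[X <- Ts]] overrides: an inner definition of X shadows an
   outer one. *)
Inductive typ_s : genv -> proc -> env -> Prop :=
| TsSub G P D D' :
    typ_s G P D -> env_le le_s D D' -> typ_s G P D'
| TsNil G : typ_s G PNil env0
| TsCall (G : genv) (X : pvar) (us : seq ident) Ts :
    G.[? X] = Some Ts -> size us = size Ts -> uniq us ->
    typ_s G (PCall X us) (env_of us Ts)
| TsIn G (u : ident) (pbs : seq (label * (var * proc))) (tbs : seq branch) (D : env) :
    wf (TIn tbs) ->
    map fst pbs = map fst tbs ->
    u \notin domf D ->
    (forall l x P, List.In (l, (x, P)) pbs -> Var x != u /\ Var x \notin domf D) ->
    (forall l x P S T, List.In (l, (x, P)) pbs -> List.In (l, (S, T)) tbs ->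
       typ_s G P D.[u <- T].[Var x <- S]) ->
    typ_s G (PIn u pbs) D.[u <- TIn tbs]
| TsOut G (u : ident) l (u' : ident) P (D : env) S T :
    wf S -> u \notin domf D -> u' \notin domf D -> u != u' ->
    typ_s G P D.[u <- T] ->
    typ_s G (POut u l u' P) D.[u <- TOut [:: (l, (S, T))]].[u' <- S]
| TsPar G P1 P2 (D1 D2 : env) :
    [disjoint domf D1 & domf D2] ->
    typ_s G P1 D1 -> typ_s G P2 D2 -> typ_s G (PPar P1 P2) (D1 + D2)
| TsChoice G P1 P2 D :
    typ_s G P1 D -> typ_s G P2 D -> typ_s G (PChoice P1 P2) D
| TsDef (G : genv) (X : pvar) (xs : seq var) Ts P Q D :
    all wf Ts -> size xs = size Ts -> uniq xs ->
    typ_s G.[X <- Ts] P (env_of (map Var xs) Ts) ->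
    typ_s G.[X <- Ts] Q D ->
    typ_s G (PDef X xs P Q) D
| TsRes G a b P (D : env) T :
    Chan a \notin domf D -> Chan b \notin domf D -> a != b ->
    typ_s G P D.[Chan a <- T].[Chan b <- dual T] ->
    typ_s G (PRes a b P) D.

(* [remainder T tau T'] : the remainder of T after tau is defined and equals T'. *)
Inductive remainder : sty -> qtype -> sty -> Prop :=
| RemNil T : remainder T [::] T
| RemIn T bs l S0 T0 S tau T' :
    unf T = TIn bs -> List.In (l, (S0, T0)) bs -> le_a S0 S ->
    remainder T0 tau T' -> remainder T ((l, S) :: tau) T'
| RemOut T bs tau (f : label -> sty) :
    unf T = TOut bs ->
    (forall l S0 T0, List.In (l, (S0, T0)) bs -> remainder T0 tau (f l)) ->
    remainder T tau
      (TOut (map (fun b => let: (l, (S0, _)) := b in (l, (S0, f l))) bs)).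

(* [typ_a G P D Q]: Q collects the entries ab : tau of the environment. *)
Inductive typ_a : genv -> proc -> env -> qenv -> Prop :=
| TaSub G P D D' Q Q' :
    typ_a G P D Q -> env_le le_a D D' -> qenv_eq Q Q' -> typ_a G P D' Q'
| TaNil G : typ_a G PNil env0 qenv0
| TaCall (G : genv) (X : pvar) (us : seq ident) Ts :
    G.[? X] = Some Ts -> size us = size Ts -> uniq us ->
    typ_a G (PCall X us) (env_of us Ts) qenv0
| TaIn G (u : ident) (pbs : seq (label * (var * proc))) (tbs : seq branch) (D : env) Q :
    wf (TIn tbs) ->
    map fst pbs = map fst tbs ->
    u \notin domf D ->
    (forall l x P, List.In (l, (x, P)) pbs -> Var x != u /\ Var x \notin domf D) ->
    (forall l x P S T, List.In (l, (x, P)) pbs -> List.In (l, (S, T)) tbs ->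
       typ_a G P D.[u <- T].[Var x <- S] Q) ->
    typ_a G (PIn u pbs) D.[u <- TIn tbs] Q
| TaOut G (u : ident) l (u' : ident) P (D : env) Q S T :
    wf S -> u \notin domf D -> u' \notin domf D -> u != u' ->
    typ_a G P D.[u <- T] Q ->
    typ_a G (POut u l u' P) D.[u <- TOut [:: (l, (S, T))]].[u' <- S] Q
| TaPar G P1 P2 (D1 D2 : env) (Q1 Q2 : qenv) :
    [disjoint domf D1 & domf D2] -> [disjoint domf Q1 & domf Q2] ->
    typ_a G P1 D1 Q1 -> typ_a G P2 D2 Q2 ->
    typ_a G (PPar P1 P2) (D1 + D2) (Q1 + Q2)
| TaChoice G P1 P2 D Q :
    typ_a G P1 D Q -> typ_a G P2 D Q -> typ_a G (PChoice P1 P2) D Q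
| TaDef (G : genv) (X : pvar) (xs : seq var) Ts P P' D Q :
    all wf Ts -> size xs = size Ts -> uniq xs ->
    typ_a G.[X <- Ts] P (env_of (map Var xs) Ts) qenv0 ->
    typ_a G.[X <- Ts] P' D Q ->
    typ_a G (PDef X xs P P') D Q
| TaRes G a b P (D : env) (Q : qenv) T1 T2 tau1 tau2 T1' T2' :
    Chan a \notin domf D -> Chan b \notin domf D -> a != b ->
    (b, a) \notin domf Q -> (a, b) \notin domf Q ->
    remainder T1 tau1 T1' -> remainder T2 tau2 T2' -> teq T2' (dual T1') ->
    typ_a G P D.[Chan a <- T1].[Chan b <- T2]
              Q.[(b, a) <- tau1].[(a, b) <- tau2] ->
    typ_a G (PRes a b P) D Q
| TaQNil G b a : typ_a G (PQueue b a [::]) env0 qenv0.[(b, a) <- [::]]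
| TaQCons G (b a : chan) h l c (D : env) (Q : qenv) S tau :
    wf S -> Chan c \notin domf D -> (b, a) \notin domf Q ->
    typ_a G (PQueue b a h) D Q.[(b, a) <- tau] ->
    typ_a G (PQueue b a (rcons h (l, c)))
      D.[Chan c <- S] Q.[(b, a) <- rcons tau (l, S)].

Definition den_s (a : chan) (T : sty) (P : proc) : Prop :=
  [/\ wf_proc P, sync_proc P & typ_s genv0 P env0.[Chan a <- T]].

Definition den_a (a : chan) (T : sty) (P : proc) : Prop :=
  wf_proc P /\ typ_a genv0 P env0.[Chan a <- T] qenv0.

(* Main.v *)
(** Subsumption gives the direct implications.  Conversely, with P(x, T) the
characteristic process of T on x, which performs the actions of T and checks every
exchanged channel by a characteristic process of its type or of the dual type, test T by
<<def X(x) = P(x, T) in (X<a> | (nu c d)(X<c> | P(d, dual T)))>>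
(with empty queues in the asynchronous case).  If it has the type S at a, then the type W
of the parameter of X satisfies W <= S and W <= Y, where P(d, dual T) has the type dual Y
at d.  Since P(x, T) also has the type W at x, the roots of T, W and Y agree and have the
same labels, and the types of continuations and of exchanged channels are again related in
this way.  So T and W have the same tree, and T <= S.  As this only unfolds subtyping at
types whose roots agree, no delayed output has to be analysed here; such outputs matter
only for the transitivity of asynchronous subtyping. *)

Require Import Defs.
From mathcomp Require Import all_boot finmap.
From Stdlib Require List.

Set Implicit Arguments.
Unset Strict Implicit.
Unset Printing Implicit Defensive.

Local Open Scope fset_scope.
Local Open Scope fmap_scope.

(** * Closed types, substitution and unfolding *)

(** The root is always fixed by the process that receives. If T is an input, P(x, T) puts an input
    below W, so W is an input, and then so is Y. If T is a selection, P(d, dual T) puts an input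
    below dual Y, so Y is a selection, and W <= Y makes W one as well. A process that sends fixes
    nothing by itself: an asynchronous supertype of a selection may begin with inputs. Its
    inequality is inverted only after the root is known, and then yields the missing inclusion of
    labels. One-sided inversions thus suffice, and both subtypings are treated at once.

    Transitivity of asynchronous subtyping meets another obstacle: the supertype is decomposed
    existentially, up to tree equality, into a context and selections, and such decompositions are
    hard to compose. They are replaced by the inductive extraction of one label at a time, which can
    be carried along subtyping. *)

Lemma all_In (A : Type) (p : pred A) (s : seq A) :
  all p s <-> forall x, List.In x s -> p x.
Proof.
elim: s => [|y s IH] /=; first by split.
split=> [/andP[py /IH ps] x [<-|/ps] //|ps].
by apply/andP; split; [apply: ps; left | apply/IH => x xs; apply: ps; right].
Qed.

Lemma In_map (A B : Type) (f : A -> B) (s : seq A) y :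
  List.In y (map f s) <-> exists2 x, List.In x s & f x = y.
Proof.
elim: s => [|z s IH] /=; first by split=> // -[].
split=> [[e|/IH[x xs e]]|[x [<-|xs] e]].
- by exists z => //; left.
- by exists x => //; right.
- by left.
- by right; apply/IH; exists x.
Qed.

Lemma eq_In_map (A B : Type) (f g : A -> B) (s : seq A) :
  (forall x, List.In x s -> f x = g x) -> map f s = map g s.
Proof.
elim: s => [|z s IH] //= fg; congr (_ :: _); first by apply: fg; left.
by apply: IH => x xs; apply: fg; right.
Qed.

Lemma In_mem (A : eqType) (x : A) (s : seq A) : List.In x s <-> x \in s.
Proof.
elim: s => [|y s IH] //=; rewrite in_cons; split.
  by case=> [->|/IH ->]; rewrite ?eqxx ?orbT.
by case/orP => [/eqP->|/IH]; [left|right].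
Qed.

Lemma In_label (A : Type) (bs : seq (nat * A)) l b :
  List.In (l, b) bs -> l \in map fst bs.
Proof. by move=> h; apply/In_mem/In_map; exists (l, b). Qed.

Lemma label_In (A : Type) (bs : seq (nat * A)) l :
  l \in map fst bs -> exists b, List.In (l, b) bs.
Proof. by move/In_mem/In_map => [[l' b] h /= <-]; exists b. Qed.

Lemma uniq_In (A : Type) (bs : seq (nat * A)) l b b' :
  uniq (map fst bs) -> List.In (l, b) bs -> List.In (l, b') bs -> b = b'.
Proof.
elim: bs => [|[m c] bs IH] //= /andP[mbs ubs] [e|h] [e'|h'].
- by move: e e' => [_ <-] [_ <-].
- by move: e => [e _]; move: mbs; rewrite e (In_label h').
- by move: e' => [e' _]; move: mbs; rewrite e' (In_label h).
- exact: IH.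
Qed.

Section StyInd.
Variable P : sty -> Prop.
Notation branches_ind bs :=
  (forall (l : nat) (S T : sty), List.In (l, (S, T)) bs -> P S /\ P T).
Hypothesis Pend : P TEnd.
Hypothesis Pvar : forall k, P (TVar k).
Hypothesis Pmu : forall T, P T -> P (TMu T).
Hypothesis Pin : forall bs, branches_ind bs -> P (TIn bs).
Hypothesis Pout : forall bs, branches_ind bs -> P (TOut bs).

Let branches_nil : branches_ind nil.
Proof. by move=> l S T. Qed.

Let branches_cons m U V bs :
  P U -> P V -> branches_ind bs -> branches_ind ((m, (U, V)) :: bs).
Proof. by move=> PU PV h l S T /= [[_ <- <-]|/h]. Qed.

Fixpoint sty_nested_ind (T : sty) : P T :=
  let fix branches bs : branches_ind bs :=
    match bs with
    | [::] => branches_nil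
    | (m, (U, V)) :: bs' =>
        branches_cons (sty_nested_ind U) (sty_nested_ind V) (branches bs')
    end in
  match T with
  | TEnd => Pend
  | TVar k => Pvar k
  | TMu T' => Pmu (sty_nested_ind T')
  | TIn bs => Pin (branches bs)
  | TOut bs => Pout (branches bs)
  end.
End StyInd.

Definition wf_branches n (bs : seq (nat * (sty * sty))) :=
  [/\ ~~ nilp bs, uniq (map fst bs)
    & forall l S T, List.In (l, (S, T)) bs -> wf S /\ wf_at n T].

Lemma wf_branchesP n bs :
  [&& ~~ nilp bs, uniq (map fst bs)
    & all (fun b : nat * (sty * sty) => let: (_, (U, T')) := b in wf_at 0 U && wf_at n T') bs]
  <-> wf_branches n bs.
Proof.
split=> [/and3P[? ? /all_In h]|[? ? h]].
  by split=> // l S T /h /andP.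
by apply/and3P; split=> //; apply/all_In => -[l [S T]] /h [hS hT]; apply/andP.
Qed.

Lemma wf_atIn n bs : wf_at n (TIn bs) <-> wf_branches n bs.
Proof. exact: wf_branchesP. Qed.

Lemma wf_atOut n bs : wf_at n (TOut bs) <-> wf_branches n bs.
Proof. exact: wf_branchesP. Qed.

Definition map_cont (h : sty -> sty) (bs : seq (nat * (sty * sty))) :=
  map (fun b => let: (l, (U, T)) := b in (l, (U, h T))) bs.

Lemma map_fst_cont h bs : map fst (map_cont h bs) = map fst bs.
Proof. by rewrite -map_comp; apply: eq_map => -[l [S T]]. Qed.

Lemma In_map_cont h bs l S T :
  List.In (l, (S, T)) (map_cont h bs) <->
  exists2 T0, List.In (l, (S, T0)) bs & h T0 = T.
Proof.
split=> [/In_map[[m [U V]] hin [<- <- <-]]|[T0 hin <-]]; first by exists V.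
by apply/In_map; exists (l, (S, T0)).
Qed.

Lemma map_cont_ext h h' bs :
  (forall l S T, List.In (l, (S, T)) bs -> h T = h' T) ->
  map_cont h bs = map_cont h' bs.
Proof. by move=> e; apply: eq_In_map => -[l [S T]] hin; rewrite (e _ _ _ hin). Qed.

Lemma map_cont_id h bs :
  (forall l S T, List.In (l, (S, T)) bs -> h T = T) -> map_cont h bs = bs.
Proof.
by move=> e; rewrite -[RHS]map_id; apply: eq_In_map => -[l [S T]] /e ->.
Qed.

Lemma map_cont_comp h h' bs :
  map_cont h (map_cont h' bs) = map_cont (fun T => h (h' T)) bs.
Proof. by rewrite /map_cont -map_comp; apply: eq_map => -[l [S T]]. Qed.

Lemma wf_map_cont n m h bs : wf_branches n bs ->
  (forall l S T, List.In (l, (S, T)) bs -> wf_at n T -> wf_at m (h T)) ->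
  wf_branches m (map_cont h bs).
Proof.
move=> [ne un w] hw; split; last first.
- by move=> l S _ /In_map_cont[T hin <-]; have [? /(hw _ _ _ hin)] := w _ _ _ hin.
- by rewrite map_fst_cont.
- by move: ne; rewrite /nilp size_map.
Qed.

Lemma wf_at_mono T n m : n <= m -> wf_at n T -> wf_at m T.
Proof.
elim/sty_nested_ind: T n m => [|k|T IH|bs IH|bs IH] n m nm //=.
- by move/leq_trans; apply.
- by case/andP=> -> /IH ->.
- move/wf_branchesP=> w; apply/wf_branchesP.
  rewrite -[bs](@map_cont_id id) //; apply: wf_map_cont w _ => l S T hin.
  by apply: (IH _ _ _ hin).2.
- move/wf_branchesP=> w; apply/wf_branchesP.
  rewrite -[bs](@map_cont_id id) //; apply: wf_map_cont w _ => l S T hin.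
  by apply: (IH _ _ _ hin).2.
Qed.

Lemma wf_guarded T n k : wf_at n T -> n <= k -> guarded k T.
Proof.
elim: T n k => //= [j|T IH] n k.
  by move=> jn nk; rewrite neq_ltn (leq_trans jn nk).
by case/andP=> _ wT nk; apply: IH wT _.
Qed.

Lemma tsubst_closed T n k U : wf_at n T -> n <= k -> tsubst k U T = T.
Proof.
elim/sty_nested_ind: T n k => [|j|T IH|bs IH|bs IH] n k //=.
- by move=> jn nk; rewrite ltn_eqF // (leq_trans jn nk).
- by case/andP=> _ wT nk; rewrite (IH _ _ wT).
- move/wf_branchesP=> [_ _ w] nk; congr TIn; apply: map_cont_id => l S T hin.
  by apply: (IH _ _ _ hin).2 nk; apply: (w _ _ _ hin).2.
- move/wf_branchesP=> [_ _ w] nk; congr TOut; apply: map_cont_id => l S T hin.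
  by apply: (IH _ _ _ hin).2 nk; apply: (w _ _ _ hin).2.
Qed.

(* The types in s are meant to be closed, so they are not lifted under binders. *)
Fixpoint msubst (k : nat) (s : seq sty) (T : sty) : sty :=
  match T with
  | TEnd => TEnd
  | TVar j => if j < k then TVar j else nth TEnd s (j - k)
  | TMu T' => TMu (msubst k.+1 s T')
  | TIn bs => TIn (map_cont (msubst k s) bs)
  | TOut bs => TOut (map_cont (msubst k s) bs)
  end.

Lemma wf_nth s j : all wf s -> wf (nth TEnd s j).
Proof.
move=> ws; case: (ltnP j (size s)) => js; last by rewrite nth_default.
by rewrite (all_nthP _ ws).
Qed.

Lemma guarded_msubst T j k s :
  all wf s -> j < k -> guarded j T -> guarded j (msubst k s T).
Proof.
move=> ws; elim: T j k => //= [i|T IH] j k jk; last exact: IH.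
by case: ifP => //= _ _; exact: (@wf_guarded _ 0 _ (wf_nth _ ws)).
Qed.

Lemma wf_msubst T k s :
  all wf s -> wf_at (k + size s) T -> wf_at k (msubst k s T).
Proof.
move=> ws; elim/sty_nested_ind: T k => [|j|T IH|bs IH|bs IH] k //=.
- by case: (ltnP j k) => //= kj _; exact: (@wf_at_mono _ 0 _ _ (wf_nth _ ws)).
- by case/andP=> gT wT; rewrite guarded_msubst //= IH.
- move/wf_branchesP=> w; apply/wf_branchesP; apply: wf_map_cont w _ => l S T hin.
  exact: (IH _ _ _ hin).2.
- move/wf_branchesP=> w; apply/wf_branchesP; apply: wf_map_cont w _ => l S T hin.
  exact: (IH _ _ _ hin).2.
Qed.

Lemma msubst_nil T k : wf_at k T -> msubst k [::] T = T.
Proof.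
elim/sty_nested_ind: T k => [|j|T IH|bs IH|bs IH] k //=.
- by move=> ->.
- by case/andP=> _ /IH ->.
- move/wf_branchesP=> [_ _ w]; congr TIn; apply: map_cont_id => l S T hin.
  by apply: (IH _ _ _ hin).2; apply: (w _ _ _ hin).2.
- move/wf_branchesP=> [_ _ w]; congr TOut; apply: map_cont_id => l S T hin.
  by apply: (IH _ _ _ hin).2; apply: (w _ _ _ hin).2.
Qed.

Lemma tsubst_msubst T k U s : all wf s ->
  tsubst k U (msubst k.+1 s T) = msubst k (U :: s) T.
Proof.
move=> ws; elim/sty_nested_ind: T k => [|j|T IH|bs IH|bs IH] k //=.
- rewrite ltnS; case: ltngtP => [jk|kj|->] /=.
  + by rewrite ltn_eqF.
  + rewrite (@tsubst_closed _ 0 _ _ (wf_nth _ ws)) //.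
    by rewrite -(subnSK kj).
  + by rewrite eqxx subnn.
- by rewrite IH.
- rewrite [map _ _](map_cont_comp (tsubst k U)); congr TIn; apply: map_cont_ext => l S T hin.
  exact: (IH _ _ _ hin).2.
- rewrite [map _ _](map_cont_comp (tsubst k U)); congr TOut; apply: map_cont_ext => l S T hin.
  exact: (IH _ _ _ hin).2.
Qed.

(** Unfolding stays among the closed instances of subterms: the body appears under the substitution
    extended with the recursive type itself. Arguments on the syntax of a type can thereby follow
    its unfoldings. *)
Lemma unfold1_msubst s T : all wf s ->
  unfold1 (msubst 0 s (TMu T)) = msubst 0 (msubst 0 s (TMu T) :: s) T.
Proof. by move=> ws /=; rewrite tsubst_msubst. Qed.

Lemma wf_unfold1 T : wf T -> wf (unfold1 T).
Proof.
case: T => // T wT; rewrite /=.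
have -> : tsubst 0 (TMu T) T = msubst 0 [:: TMu T] T.
  by rewrite -tsubst_msubst // msubst_nil //; case/andP: wT.
by apply: wf_msubst; rewrite /= ?wT //; case/andP: wT.
Qed.

Lemma mu_height_tsubst T k U : guarded k T -> mu_height (tsubst k U T) = mu_height T.
Proof. by elim: T k => //= [j k /negPf ->|T IH k /IH ->]. Qed.

Lemma mu_height_unfold1 T : wf T -> mu_height (unfold1 T) = (mu_height T).-1.
Proof. by case: T => //= T /andP[gT _]; rewrite mu_height_tsubst. Qed.

Lemma unf_unfold1 T : wf T -> unf (unfold1 T) = unf T.
Proof.
move=> wT; rewrite /unf mu_height_unfold1 // -iterSr.
by case: T wT => //= T /andP[gT _].
Qed.

Lemma unf_ind (P : sty -> Prop) :
  (forall T, wf T -> mu_height T = 0 -> P T) ->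
  (forall T, wf (TMu T) -> P (unfold1 (TMu T)) -> P (TMu T)) ->
  forall T, wf T -> P T.
Proof.
move=> P0 P1 T; have [n] := ubnP (mu_height T); elim: n T => // n IH T hn wT.
case: T hn wT => [|k|T|bs|bs] hn wT; try exact: P0.
apply: P1 => //; apply: IH; last exact: wf_unfold1.
by rewrite mu_height_unfold1.
Qed.

Lemma wf_unf T : wf T -> wf (unf T).
Proof.
move: T; apply: unf_ind => [T wT h0|T wT]; first by rewrite /unf h0.
by rewrite unf_unfold1.
Qed.

Variant unf_spec (T : sty) : sty -> Prop :=
| UnfEnd : unf_spec T TEnd
| UnfIn bs of wf_branches 0 bs : unf_spec T (TIn bs)
| UnfOut bs of wf_branches 0 bs : unf_spec T (TOut bs).

Lemma unfP T : wf T -> unf_spec T (unf T).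
Proof.
move=> wT; have : mu_height (unf T) = 0.
  move: T wT; apply: unf_ind => [T wT h0|T wT]; first by rewrite /unf h0.
  by rewrite unf_unfold1.
have := wf_unf wT; case: (unf T) => //= [_ _|bs w _|bs w _]; first by constructor.
  by constructor; apply/wf_branchesP.
by constructor; apply/wf_branchesP.
Qed.

Lemma wf_unfIn T bs : wf T -> unf T = TIn bs -> wf_branches 0 bs.
Proof. by move=> /wf_unf w e; apply/wf_atIn; rewrite -e. Qed.

Lemma wf_unfOut T bs : wf T -> unf T = TOut bs -> wf_branches 0 bs.
Proof. by move=> /wf_unf w e; apply/wf_atOut; rewrite -e. Qed.

Lemma dual_tsubst T k U : dual (tsubst k U T) = tsubst k (dual U) (dual T).
Proof.
elim/sty_nested_ind: T k => [|j|T IH|bs IH|bs IH] k //=.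
- by case: ifP.
- by rewrite IH.
- rewrite [map _ _](map_cont_comp dual) [RHS](f_equal TOut (map_cont_comp _ _ _)).
  by congr TOut; apply: map_cont_ext => l S T hin; apply: (IH _ _ _ hin).2.
- rewrite [map _ _](map_cont_comp dual) [RHS](f_equal TIn (map_cont_comp _ _ _)).
  by congr TIn; apply: map_cont_ext => l S T hin; apply: (IH _ _ _ hin).2.
Qed.

Lemma guarded_dual T k : guarded k (dual T) = guarded k T.
Proof. by elim: T k => //=. Qed.

Lemma wf_dual_at T n : wf_at n T -> wf_at n (dual T).
Proof.
elim/sty_nested_ind: T n => [|j|T IH|bs IH|bs IH] n //=.
- by rewrite guarded_dual => /andP[-> /IH ->].
- move/wf_branchesP=> w; apply/wf_branchesP; apply: wf_map_cont w _ => l S T hin.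
  exact: (IH _ _ _ hin).2.
- move/wf_branchesP=> w; apply/wf_branchesP; apply: wf_map_cont w _ => l S T hin.
  exact: (IH _ _ _ hin).2.
Qed.

Lemma wf_dual T : wf T -> wf (dual T).
Proof. exact: wf_dual_at. Qed.

Lemma unf_dual T : wf T -> unf (dual T) = dual (unf T).
Proof.
move: T; apply: unf_ind => [T wT h0|T wT IH].
  by case: T wT h0.
rewrite -[in RHS]unf_unfold1 // -IH -[LHS]unf_unfold1; last exact: wf_dual.
by rewrite /= dual_tsubst.
Qed.

(** * Coinduction, tree equality and synchronous subtyping *)

Definition mono_step (F : (sty -> sty -> Prop) -> sty -> sty -> Prop) :=
  forall R R' : sty -> sty -> Prop, (forall T S, R T S -> R' T S) ->
  forall T S, F R T S -> F R' T S.

Lemma largest_coind F (R : sty -> sty -> Prop) :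
  (forall T S, R T S -> [/\ wf T, wf S & F R T S]) ->
  forall T S, R T S -> largest F T S.
Proof. by move=> h T S r; exists R. Qed.

Lemma largest_unfold F : mono_step F -> forall T S, largest F T S ->
  [/\ wf T, wf S & F (largest F) T S].
Proof.
move=> m T S [R [h r]]; have [wT wS f] := h _ _ r; split=> //.
by apply: m f => T' S'; apply: largest_coind.
Qed.

(** By monotonicity, F applied to the largest relation is again a candidate, hence included in
    it. *)
Lemma largest_fold F : mono_step F -> forall T S, wf T -> wf S ->
  F (largest F) T S -> largest F T S.
Proof.
move=> m T S wT wS f.
apply: (@largest_coind _ (fun T S => [/\ wf T, wf S & F (largest F) T S])) => //.
move=> T' S' [wT' wS' f']; split=> //; apply: (m) f' => T1 S1.
exact: (largest_unfold m).
Qed.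

Lemma mono_teq_step : mono_step teq_step.
Proof.
have mono_branches R R' : (forall T S, R T S -> R' T S) ->
    forall bs bs', branches_eq R bs bs' -> branches_eq R' bs bs'.
  move=> sub bs bs' [h h']; split.
    by move=> l S T /h [S' [T' [? ? ?]]]; exists S', T'; split=> //; apply: sub.
  by move=> l S T /h' [S' [T' [? ? ?]]]; exists S', T'; split=> //; apply: sub.
move=> R R' sub T S [e e'|bs bs' e e' h|bs bs' e e' h].
- exact: TeqEnd.
- by apply: TeqIn e e' _; apply: mono_branches h.
- by apply: TeqOut e e' _; apply: mono_branches h.
Qed.

Lemma mono_le_s_step : mono_step le_s_step.
Proof.
move=> R R' sub T S [e e'|bs bs' e e' h|bs bs' e e' h].
- exact: LeEnd.
- apply: LeIn e e' _ => l S' T' /h [S0 [T0 [? ? ?]]].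
  by exists S0, T0; split=> //; apply: sub.
- apply: LeOut e e' _ => l S' T' /h [S0 [T0 [? ? ?]]].
  by exists S0, T0; split=> //; apply: sub.
Qed.

Lemma mono_le_a_step : mono_step le_a_step.
Proof.
move=> R R' sub T S [h|bs A cs e e' inA h].
  by apply: LeSync; apply: mono_le_s_step h.
apply: LeAsync e e' inA _ => l S0 T0 /h [hT0 [Sn [Tn [hn r]]]]; split=> //.
by exists Sn, Tn; split=> [n /hn [? ?]|]; [split=> //|]; apply: sub.
Qed.

Lemma teqE T S : teq T S -> [/\ wf T, wf S & teq_step teq T S].
Proof. exact: (largest_unfold mono_teq_step). Qed.

(** Only the roots need comparing: below them both types have literally the same subterms, so having
    the same [unf] is preserved by a step. *)
Lemma teq_unf T S : wf T -> wf S -> unf T = unf S -> teq T S.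
Proof.
move=> wT wS e.
apply: (@largest_coind _ (fun T S => [/\ wf T, wf S & unf T = unf S])) => //.
move=> {wT wS e}T {}S [wT wS e]; split=> //; move: e.
have br bs : wf_branches 0 bs ->
    branches_eq (fun T S => [/\ wf T, wf S & unf T = unf S]) bs bs.
  by case=> _ _ w; split=> l U V hin; have [? ?] := w _ _ _ hin; exists U, V.
case eT: (unf T) / (unfP wT) => [|bs w|bs w] e.
- exact: TeqEnd.
- by apply: TeqIn (br _ w) => //; rewrite -e.
- by apply: TeqOut (br _ w) => //; rewrite -e.
Qed.

Lemma teq_refl T : wf T -> teq T T.
Proof. by move=> wT; apply: teq_unf. Qed.

Lemma teq_sym T S : teq T S -> teq S T.
Proof.
apply: (@largest_coind _ (fun T S => teq S T)) => {}T {}S /teqE [wS wT st].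
split=> //; case: st => [e e'|bs bs' e e' [h h']|bs bs' e e' [h h']].
- exact: TeqEnd.
- apply: TeqIn e' e _; split=> l U V.
    by move/h' => [U' [V' [? ? ?]]]; exists U', V'.
  by move/h => [U' [V' [? ? ?]]]; exists U', V'.
- apply: TeqOut e' e _; split=> l U V.
    by move/h' => [U' [V' [? ? ?]]]; exists U', V'.
  by move/h => [U' [V' [? ? ?]]]; exists U', V'.
Qed.

Definition comp (R R' : sty -> sty -> Prop) T V := exists2 S, R T S & R' S V.

Lemma teq_trans S T V : teq T S -> teq S V -> teq T V.
Proof.
move=> tTS tSV; apply: (@largest_coind _ (comp teq teq)); last by exists S.
move=> {tTS tSV S}T {}V [S /teqE[wT wS st] /teqE[_ wV st']]; split=> //.
have br bs bs1 bs2 : branches_eq teq bs bs1 -> branches_eq teq bs1 bs2 ->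
    branches_eq (comp teq teq) bs bs2.
  move=> [h1 h1'] [h2 h2']; split=> l U W.
    move/h1 => [U1 [W1 [/h2[U2 [W2 [? ? ?]]] ? ?]]]; exists U2, W2.
    by split=> //; [exists U1|exists W1].
  move/h2' => [U1 [W1 [/h1'[U2 [W2 [? ? ?]]] ? ?]]]; exists U2, W2.
  by split=> //; [exists U1|exists W1].
case: st st' => [e1 e2|bs bs1 e1 e2 h|bs bs1 e1 e2 h]
  [e3 e4|bs2 bs3 e3 e4 h'|bs2 bs3 e3 e4 h']; try congruence.
- exact: TeqEnd.
- by apply: TeqIn e1 e4 _; apply: br h _; move: e3 h'; rewrite e2 => -[->].
- by apply: TeqOut e1 e4 _; apply: br h _; move: e3 h'; rewrite e2 => -[->].
Qed.

Lemma teq_dual T S : teq T S -> teq (dual T) (dual S).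
Proof.
(* Duality leaves exchanged types alone, so the candidate relation must also contain [teq]
   itself. *)
move=> tTS; pose R T S := teq T S \/ exists T0 S0, [/\ teq T0 S0, T = dual T0 & S = dual S0].
apply: (@largest_coind _ R); last by right; exists T, S.
have br bs bs' : branches_eq teq bs bs' ->
    branches_eq R (map_cont dual bs) (map_cont dual bs').
  move=> [h h']; split=> l U _ /In_map_cont [V hin <-].
    have [U' [V' [hin' ? ?]]] := h _ _ _ hin.
    exists U', (dual V'); split; first by apply/In_map_cont; exists V'.
      by left.
    by right; exists V, V'.
  have [U' [V' [hin' ? ?]]] := h' _ _ _ hin.
  exists U', (dual V'); split; first by apply/In_map_cont; exists V'.
    by left.
  by right; exists V', V.
move=> {tTS}T {}S [/teqE [wT wS st]|[T0 [S0 [/teqE [wT wS st] -> ->]]]].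
  by split=> //; apply: mono_teq_step st => T' S'; left.
split; [exact: wf_dual|exact: wf_dual|].
case: st => [e e'|bs bs' e e' h|bs bs' e e' h].
- by apply: TeqEnd; rewrite unf_dual // ?e ?e'.
- by apply: TeqOut (br _ _ h); rewrite unf_dual // ?e ?e'.
- by apply: TeqIn (br _ _ h); rewrite unf_dual // ?e ?e'.
Qed.

(** A finite choice, provable by induction on the list. As labels are distinct, the witnesses can be
    indexed by labels. *)
Lemma branch_choice (A : Type) (x0 : A) (bs : seq (nat * (sty * sty)))
    (Q : nat -> sty -> sty -> A -> Prop) :
  uniq (map fst bs) ->
  (forall l U V, List.In (l, (U, V)) bs -> exists x, Q l U V x) ->
  exists g : nat -> A, forall l U V, List.In (l, (U, V)) bs -> Q l U V (g l).
Proof.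
elim: bs => [|[m [U0 V0]] bs IH] /=; first by exists (fun=> x0).
case/andP=> mbs ubs h.
have [|g hg] := IH ubs; first by move=> l U V hin; apply: h; right.
have [x hx] := h m U0 V0 (or_introl erefl).
exists (fun l => if l == m then x else g l) => l U V [[<- <- <-]|hin].
  by rewrite eqxx.
case: eqP => [e|_]; last exact: hg.
by move: mbs; rewrite -e (In_label hin).
Qed.

(** The shape in which [RemOut] rebuilds a selection. It is polymorphic because the new
    continuations may also be contexts, the result then being the argument of [AIn]. *)
Definition relabel (A : Type) (g : nat -> A) (bs : seq (nat * (sty * sty))) :=
  map (fun b => let: (l, (U, _)) := b in (l, (U, g l))) bs.

Lemma In_relabel (A : Type) (g : nat -> A) bs l U x :
  List.In (l, (U, x)) (relabel g bs) <->
  (exists V, List.In (l, (U, V)) bs) /\ x = g l.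
Proof.
split=> [/In_map[[m [U' V]] hin [<- <- <-]]|[[V hin] ->]]; first by split=> //; exists V.
by apply/In_map; exists (l, (U, V)).
Qed.

Lemma wf_relabel bs g : wf_branches 0 bs ->
  (forall l U V, List.In (l, (U, V)) bs -> wf (g l)) ->
  wf_branches 0 (relabel g bs).
Proof.
move=> [ne un w] hg; split.
- by move: ne; rewrite /nilp size_map.
- by rewrite -map_comp (@eq_map _ _ _ fst) // => -[l [U V]].
- by move=> l U _ /In_relabel [[V hin] ->]; split; [case: (w _ _ _ hin)|apply: hg hin].
Qed.

Lemma branches_eq_relabel bs g : wf_branches 0 bs ->
  (forall l U V, List.In (l, (U, V)) bs -> teq V (g l)) ->
  branches_eq teq bs (relabel g bs).
Proof.
move=> [_ un w] hg; split=> l U V.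
  move=> hin; exists U, (g l); split; last exact: hg hin.
    by apply/In_relabel; split=> //; exists V.
  by apply: teq_refl; case: (w _ _ _ hin).
move=> /In_relabel [[V' hin] ->]; exists U, V'; split=> //; last exact: hg hin.
by apply: teq_refl; case: (w _ _ _ hin).
Qed.

Lemma teq_relabelIn T bs g : wf T -> unf T = TIn bs ->
  (forall l U V, List.In (l, (U, V)) bs -> teq V (g l)) ->
  teq T (TIn (relabel g bs)).
Proof.
move=> wT e hg; have w := wf_unfIn wT e.
apply: (largest_fold mono_teq_step) => //.
  by apply/wf_atIn/wf_relabel => // l U V /hg /teqE [].
by apply: TeqIn e _ _ => //; apply: branches_eq_relabel.
Qed.

Lemma teq_relabelOut T bs g : wf T -> unf T = TOut bs ->
  (forall l U V, List.In (l, (U, V)) bs -> teq V (g l)) ->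
  teq T (TOut (relabel g bs)).
Proof.
move=> wT e hg; have w := wf_unfOut wT e.
apply: (largest_fold mono_teq_step) => //.
  by apply/wf_atOut/wf_relabel => // l U V /hg /teqE [].
by apply: TeqOut e _ _ => //; apply: branches_eq_relabel.
Qed.

Lemma le_sE T S : le_s T S -> [/\ wf T, wf S & le_s_step le_s T S].
Proof. exact: (largest_unfold mono_le_s_step). Qed.

Lemma le_s_step_of_teq R T S : (forall T S, R T S -> R S T) ->
  teq_step R T S -> le_s_step R T S.
Proof.
move=> sym [e e'|bs bs' e e' [_ h]|bs bs' e e' [h _]].
- exact: LeEnd.
- exact: LeIn e e' h.
- apply: LeOut e e' _ => l U V /h [U' [V' [? /sym ? ?]]].
  by exists U', V'.
Qed.

Lemma le_s_step_comp R T S V : le_s_step R T S -> le_s_step R S V ->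
  le_s_step (comp R R) T V.
Proof.
case=> [e1 e2|bs bs1 e1 e2 h|bs bs1 e1 e2 h]
  [e3 e4|bs2 bs3 e3 e4 h'|bs2 bs3 e3 e4 h']; try congruence.
- exact: LeEnd.
- apply: LeIn e1 e4 _ => l U W /h' [U1 [W1 [hin ? ?]]].
  have {}hin : List.In (l, (U1, W1)) bs1 by move: e3 hin; rewrite e2 => -[->].
  have [U2 [W2 [? ? ?]]] := h _ _ _ hin.
  by exists U2, W2; split=> //; [exists U1|exists W1].
- apply: LeOut e1 e4 _ => l U W /h [U1 [W1 [hin ? ?]]].
  have {}hin : List.In (l, (U1, W1)) bs2 by move: e3; rewrite e2 => -[<-].
  have [U2 [W2 [? ? ?]]] := h' _ _ _ hin.
  by exists U2, W2; split=> //; [exists U1|exists W1].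
Qed.

Lemma teq_le_s T S : teq T S -> le_s T S.
Proof.
apply: largest_coind => {}T {}S /teqE [? ? st]; split=> //.
by apply: le_s_step_of_teq st; apply: teq_sym.
Qed.

Lemma le_s_trans S T V : le_s T S -> le_s S V -> le_s T V.
Proof.
move=> h h'; apply: (@largest_coind _ (comp le_s le_s)); last by exists S.
move=> {h h'}T {}V [{}S /le_sE[wT wS st] /le_sE[_ wV st']]; split=> //.
exact: le_s_step_comp st st'.
Qed.

(** * Extraction of outputs in asynchronous subtyping *)

Lemma has_in_tsubst T k U : has_in (tsubst k U T) -> has_in T \/ has_in U.
Proof.
elim/sty_nested_ind: T k => [|j|T IH|bs IH|bs IH] k /= h.
- by inversion h.
- by case: ifP h; [right|left].
- by inversion h; subst; case: (IH k.+1) => // ?; [left; constructor|right].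
- by left; constructor.
- have {h} : forall l S T, List.In (l, (S, T)) bs -> has_in T \/ has_in U.
    move=> l S T hin; apply: (IH _ _ _ hin).2 (k) _.
    inversion h as [|bs' h' e|]; apply: (h' l S).
    by apply/(In_map_cont (tsubst k U)); exists T.
  move=> h; suff [hT|] : (forall l S T, List.In (l, (S, T)) bs -> has_in T) \/ has_in U.
  + by left; constructor.
  + by right.
  (* The alternative is moved out of the quantification over branches, which is constructive because
     there are finitely many of them. *)
  elim: bs h {IH} => [|[m [V W]] bs IH] h; first by left.
  have [hW|] := h m V W (or_introl erefl); last by right.
  have [|hbs|] := IH; last by right.
    by move=> l S T hin; apply: (h l S); right.
  by left=> l S T [[_ _ <-]|/hbs].
Qed.

Lemma tsubst_has_in T k U : has_in T -> has_in (tsubst k U T).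
Proof.
elim/sty_nested_ind: T k => [|j|T IH|bs IH|bs IH] k /= h; try by inversion h.
- by inversion h; constructor; apply: IH.
- by constructor.
- constructor=> l S _ /(In_map_cont (tsubst k U)) [T hin <-].
  apply: (IH _ _ _ hin).2; inversion h as [|bs' h' e|]; exact: h' hin.
Qed.

Lemma has_in_unf T : wf T -> has_in (unf T) <-> has_in T.
Proof.
move: T; apply: unf_ind => [T wT h0|T wT]; first by rewrite /unf h0.
rewrite unf_unfold1 // => ->; split=> /= h.
  by case: (has_in_tsubst h) => // ?; constructor.
by apply: tsubst_has_in; inversion h.
Qed.

Lemma has_in_In T bs : wf T -> unf T = TIn bs -> has_in T.
Proof. by move=> wT e; apply/has_in_unf => //; rewrite e; constructor. Qed.

Lemma has_in_OutP T bs : wf T -> unf T = TOut bs ->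
  has_in T <-> (forall l S0 T0, List.In (l, (S0, T0)) bs -> has_in T0).
Proof.
move=> wT e; split=> [/(has_in_unf wT)|h].
  by rewrite e => h; inversion h as [|bs' h' e'|].
by apply/has_in_unf => //; rewrite e; constructor.
Qed.

(* [has_in] on the tree of T, so that inductions follow the branches of T rather
   than its syntax. *)
Inductive tree_in (T : sty) : Prop :=
| TreeIn bs of unf T = TIn bs
| TreeOut bs of unf T = TOut bs &
    (forall l S0 T0, List.In (l, (S0, T0)) bs -> tree_in T0).

(** Induction on [has_in] reaches open bodies, hence the closing substitution; at a binder it is
    extended with the recursive type itself. *)
Lemma tree_in_msubst T s : has_in T -> all wf s -> wf_at (size s) T ->
  tree_in (msubst 0 s T).
Proof.
move=> h; elim: h s => {T} [bs|bs _ IH|T _ IH] s ws wT /=.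
- exact: (TreeIn (bs := map_cont (msubst 0 s) bs)).
- apply: (TreeOut (bs := map_cont (msubst 0 s) bs)) => // l S _ /In_map_cont [T hin <-].
  have /wf_branchesP [_ _ w] := wT.
  by apply: (IH _ _ _ hin); case: (w _ _ _ hin).
- have wU : wf (msubst 0 s (TMu T)) by apply: wf_msubst.
  have wT' : wf_at (size s).+1 T by case/andP: wT.
  have ws' : all wf (msubst 0 s (TMu T) :: s) by apply/andP.
  move: (IH _ ws' wT'); rewrite -unfold1_msubst // -/(msubst 0 s (TMu T)).
  case=> [bs|bs]; rewrite unf_unfold1 //; [exact: TreeIn|exact: TreeOut].
Qed.

Lemma has_in_tree T : wf T -> has_in T -> tree_in T.
Proof. by move=> wT h; rewrite -(msubst_nil wT); apply: tree_in_msubst. Qed.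

Lemma teq_has_in T S : teq T S -> has_in S -> has_in T.
Proof.
move=> tTS; have [_ wS _] := teqE tTS; move/(has_in_tree wS) => h.
elim: h T tTS {wS} => [{}S bs e|{}S bs e _ IH] T /teqE[wT wS].
  case=> [_|bs1 bs2 e1 _ _|bs1 bs2 _]; try by rewrite e.
  exact: has_in_In e1.
case=> [_|bs1 bs2 _|bs1 bs2 e1 e2 [h _]]; try by rewrite e.
apply/(has_in_OutP wT e1) => l U V /h [U' [V' [hin _ tV]]].
by apply: (IH l U' V') tV; move: e2 hin; rewrite e => -[->].
Qed.

(* [oext l P S S']: S selects l, with an exchanged type satisfying P, after
   finitely many inputs, and S' is S without this selection. *)
Inductive oext (l : nat) (P : sty -> Prop) (T : sty) : sty -> Prop :=
| OextOut bs S0 T0 of unf T = TOut bs & List.In (l, (S0, T0)) bs & P S0 :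
    oext l P T T0
| OextIn bs (g : nat -> sty) of unf T = TIn bs &
    (forall m U V, List.In (m, (U, V)) bs -> oext l P V (g m)) :
    oext l P T (TIn (relabel g bs)).

Lemma oext_mono l P Q T T' : (forall U, P U -> Q U) -> oext l P T T' -> oext l Q T T'.
Proof.
move=> PQ; elim=> {T'} [{}T bs S0 T0 e hin /PQ|{}T bs g e _ IH].
  exact: OextOut e hin.
exact: OextIn e IH.
Qed.

Lemma wf_oext l P T T' : wf T -> oext l P T T' -> wf T'.
Proof.
move=> wT h; elim: h wT => {T'} [{}T bs S0 T0 e hin _|{}T bs g e _ IH] wT.
  by have [_ _ w] := wf_unfOut wT e; case: (w _ _ _ hin).
have wb := wf_unfIn wT e; apply/wf_atIn/wf_relabel => // m U V hin.
by apply: (IH _ _ _ hin); case: wb => _ _ w; case: (w _ _ _ hin).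
Qed.

Section ActxInd.
Variable P : actx -> Prop.
Notation branches_ind bs :=
  (forall (l : nat) (U : sty) (A : actx), List.In (l, (U, A)) bs -> P A).
Hypothesis Phole : forall n, P (AHole n).
Hypothesis Pin : forall bs, branches_ind bs -> P (AIn bs).

Let branches_nil : branches_ind nil.
Proof. by move=> l U A. Qed.

Let branches_cons m V B bs : P B -> branches_ind bs -> branches_ind ((m, (V, B)) :: bs).
Proof. by move=> PB h l U A /= [[_ _ <-]|/h]. Qed.

Fixpoint actx_nested_ind (A : actx) : P A :=
  let fix branches bs : branches_ind bs :=
    match bs with
    | [::] => branches_nil
    | (m, (V, B)) :: bs' => branches_cons (actx_nested_ind B) (branches bs')
    end in
  match A with
  | AHole n => Phole n
  | AIn bs => Pin (branches bs)
  end.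
End ActxInd.

Lemma holes_In (bs : seq (nat * (sty * actx))) l U A n :
  List.In (l, (U, A)) bs -> n \in holes A -> n \in holes (AIn bs).
Proof.
move=> hin hn; apply/flattenP; exists (holes A) => //.
by apply/In_mem/In_map; exists (l, (U, A)).
Qed.

Lemma In_fill (bs : seq (nat * (sty * actx))) (f : nat -> sty) l U V :
  List.In (l, (U, V))
    (map (fun b : nat * (sty * actx) => let: (l, (U, A')) := b in (l, (U, fill A' f))) bs) <->
  exists2 A, List.In (l, (U, A)) bs & V = fill A f.
Proof.
split=> [/In_map[[m [U' A]] hin [<- <- <-]]|[A hin ->]]; first by exists A.
by apply/In_map; exists (l, (U, A)).
Qed.

(** Turns a decomposition into an extraction from S itself: inputs of the context are matched with
    those of S by label, holes with selections. S is only tree equal to the filled context, so P has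
    to be stable under tree equality. *)
Lemma fill_oext (P : sty -> Prop) l (cs : nat -> seq (nat * (sty * sty)))
    (Sn Tn : nat -> sty) :
  (forall U V, teq U V -> P V -> P U) ->
  forall A S, teq S (fill A (fun n => TOut (cs n))) ->
  (forall n, n \in holes A -> List.In (l, (Sn n, Tn n)) (cs n) /\ P (Sn n)) ->
  exists2 S', oext l P S S' & teq (fill A Tn) S'.
Proof.
move=> Pteq; elim/actx_nested_ind => [n|bs IH] S /teqE[wS wA st] hn.
  case: st => // bs1 bs2 e1 [<-] [_ h].
  have [|hin PS] := hn n; first by rewrite inE.
  have [U [V [hin' tU tV]]] := h _ _ _ hin.
  exists V; last exact: teq_sym.
  by apply: OextOut e1 hin' _; apply: Pteq tU PS.
case: st => // bs1 bs2 e1 [<-] [h h'].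
have [_ un1 w1] := wf_unfIn wS e1.
have /wf_atIn [ne2 un2 _] := wA.
(* The sub-context producing x is recorded too: the final tree equality must be checked from the
   branches of the context as well, and distinct labels identify the two sub-contexts. *)
pose Q (m : nat) (U V x : sty) := oext l P V x /\
  exists2 A, (exists2 U', List.In (m, (U', A)) bs & teq U U') & teq (fill A Tn) x.
have [m U V hin|g hg] := @branch_choice _ TEnd bs1 Q un1.
  have [U' [_ [/In_fill[A hA ->] tU tV]]] := h _ _ _ hin.
  have [|x ox tx] := IH _ _ _ hA _ tV; first by move=> n /(holes_In hA) /hn.
  by exists x; split=> //; exists A => //; exists U'.
exists (TIn (relabel g bs1)).
  by apply: OextIn e1 _ => m U V /hg [].
have corr m U A : List.In (m, (U, A)) bs ->
    exists U' V', [/\ List.In (m, (U', V')) bs1, teq U U' & teq (fill A Tn) (g m)].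
  move=> hA; have /h' [U1 [V1 [hin tU _]]] :
    List.In (m, (U, fill A (fun n => TOut (cs n))))
      (map (fun b : nat * (sty * actx) => let: (l, (U, A')) := b in
              (l, (U, fill A' (fun n => TOut (cs n))))) bs).
    by apply/In_fill; exists A.
  exists U1, V1; split=> //; first exact: teq_sym.
  have [_ [A' [U' hA' tU'] tA']] := hg _ _ _ hin.
  have lab : uniq (map fst bs).
    by move: un2; rewrite -map_comp (@eq_map _ _ _ fst) // => -[? []].
  by have [_ <-] := uniq_In lab hA' hA.
apply: (largest_fold mono_teq_step).
- apply/wf_atIn; split.
  + by move: ne2; rewrite /nilp !size_map.
  + by move: un2; rewrite -!map_comp !(@eq_map _ _ _ fst) // => -[? []].
  + by move=> m U _ /In_fill[A hA ->]; have [U' [V' [_ /teqE[] ? _ _ /teqE[]]]] := corr _ _ _ hA.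
- apply/wf_atIn/wf_relabel; first exact: wf_unfIn e1.
  by move=> m U V /hg [_ [A _ /teqE[]]].
apply: TeqIn => //; split=> m U.
  move=> _ /In_fill[A hA ->]; have [U' [V' [hin tU tV]]] := corr _ _ _ hA.
  by exists U', (g m); split=> //; apply/In_relabel; split=> //; exists V'.
move=> _ /In_relabel[[V hin] ->]; have [_ [A [U' hA tU] tA]] := hg _ _ _ hin.
exists U', (fill A Tn); split=> //; last exact: teq_sym.
by apply/In_fill; exists A.
Qed.

Lemma le_aE T S : le_a T S -> [/\ wf T, wf S & le_a_step le_a T S].
Proof. exact: (largest_unfold mono_le_a_step). Qed.

(** Proved before transitivity, which relies on it. In the delayed case, tree equality on the right
    is absorbed by the one already present in [LeAsync]. *)
Lemma le_a_teq T T' S S' : teq T T' -> le_a T' S' -> teq S' S -> le_a T S.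
Proof.
pose R T S := exists T' S', [/\ teq T T', le_a T' S' & teq S' S].
move=> t l t'; apply: (@largest_coind _ R); last by exists T', S'.
move=> {t l t' S' T'}{}T {}S [T' [S' [tT lTS tS]]].
have [wT _ stT] := teqE tT; have [_ wS stS] := teqE tS; have [_ _ st] := le_aE lTS.
split=> //; have R_le U V : le_a U V -> R U V.
  by move=> lUV; have [? ? _] := le_aE lUV; exists U, V; split=> //; apply: teq_refl.
case: st => [st|bs A cs e tA inA h].
  apply: LeSync; have sub (U V : sty) : comp (comp teq le_a) teq U V -> R U V.
    by case=> V' [U' ? ?] ?; exists U', V'.
  move: st stT stS => -[e1 e2|bs bs' e1 e2 h|bs bs' e1 e2 h]
    [e3 e4|bs3 bs4 e3 e4 [h3 h3']|bs3 bs4 e3 e4 [h3 h3']]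
    [e5 e6|bs5 bs6 e5 e6 [h5 h5']|bs5 bs6 e5 e6 [h5 h5']]; try congruence.
  - exact: LeEnd.
  - have ? : bs4 = bs by congruence.
    have ? : bs5 = bs' by congruence.
    subst bs4 bs5; apply: LeIn e3 e6 _ => l U V /h5' [U5 [V5 [/h hin t5 t5']]].
    have {hin}[U4 [V4 [/h3' hin l4 l4']]] := hin.
    have [U3 [V3 [hin3 t3 t3']]] := hin.
    by exists U3, V3; split=> //; [exists U4, U5|exists V4, V5].
  - have ? : bs4 = bs by congruence.
    have ? : bs5 = bs' by congruence.
    subst bs4 bs5; apply: LeOut e3 e6 _ => l U V /h3 [U4 [V4 [/h hin t4 t4']]].
    have {hin}[U5 [V5 [/h5 hin l5 l5']]] := hin.
    have [U6 [V6 [hin6 t6 t6']]] := hin.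
    exists U6, V6; split=> //; last by exists V4, V5.
    by exists U5, U4; split=> //; exact: teq_sym.
case: stT => [|bs1 bs2 _|bs1 bs2 e1 e2 [h1 _]]; try by rewrite e.
have ? : bs2 = bs by congruence.
subst bs2; apply: LeAsync e1 (teq_trans (teq_sym tS) tA) inA _.
move=> l U V /h1 [U' [V' [/h hin tU tV]]].
have {hin}[hV [Sn [Tn [hn lV]]]] := hin.
split; first exact: teq_has_in tV hV.
exists Sn, Tn; split; last first.
  exists V', (fill A Tn); split=> //; apply: teq_refl.
  by case: (le_aE lV).
move=> n /hn [hin lS]; split=> //; exists (Sn n), U'; split=> //.
  by apply: teq_refl; case: (le_aE lS).
exact: teq_sym.
Qed.

(* The decomposition of S is determined by its tree: the holes are the first
   selections on every path.  Hence the selections may be extracted label by label. *)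
Definition le_a_tree_step (R : sty -> sty -> Prop) (T S : sty) : Prop :=
  le_s_step R T S \/
  exists bs bs', [/\ unf T = TOut bs, unf S = TIn bs' &
    forall l S0 T0, List.In (l, (S0, T0)) bs ->
      has_in T0 /\ exists2 S', oext l (R^~ S0) S S' & R T0 S'].

Lemma le_a_tree T S : le_a T S -> le_a_tree_step le_a T S.
Proof.
move/le_aE => [wT wS [st|bs A cs e tA inA h]]; first by left.
right; have [bs' e'] : exists bs', unf S = TIn bs'.
  by case: A inA tA {h} => // bs' _ /teqE[_ _ [|b1 b2 ? _ _|]] //; exists b1.
exists bs, bs'; split=> // l U V /h [hV [Sn [Tn [hn lV]]]]; split=> //.
have [U1 V1 t l1|S' o t] := @fill_oext (le_a^~ U) l cs Sn Tn _ _ _ tA hn.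
  by have [_ wU _] := le_aE l1; apply: le_a_teq t l1 (teq_refl wU).
have [wV _ _] := le_aE lV.
by exists S' => //; apply: le_a_teq (teq_refl wV) lV t.
Qed.

(** An encoding into generic trees makes types countable, so that a selection can be coded by a
    natural number, the index of a hole. *)
Fixpoint sty_tree (T : sty) : GenTree.tree nat :=
  match T with
  | TEnd => GenTree.Leaf 0
  | TVar k => GenTree.Leaf k.+1
  | TMu T' => GenTree.Node 0 [:: sty_tree T']
  | TIn bs => GenTree.Node 1
      (map (fun b => let: (l, (U, V)) := b in GenTree.Node l [:: sty_tree U; sty_tree V]) bs)
  | TOut bs => GenTree.Node 2
      (map (fun b => let: (l, (U, V)) := b in GenTree.Node l [:: sty_tree U; sty_tree V]) bs)
  end.

Fixpoint tree_sty (t : GenTree.tree nat) : sty :=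
  let branch t' :=
    match t' with
    | GenTree.Node l [:: u; v] => (l, (tree_sty u, tree_sty v))
    | _ => (0, (TEnd, TEnd))
    end in
  match t with
  | GenTree.Leaf k.+1 => TVar k
  | GenTree.Node 0 [:: t'] => TMu (tree_sty t')
  | GenTree.Node 1 ts => TIn (map branch ts)
  | GenTree.Node 2 ts => TOut (map branch ts)
  | _ => TEnd
  end.

Lemma sty_treeK : cancel sty_tree tree_sty.
Proof.
elim/sty_nested_ind => [|k|T IH|bs IH|bs IH] //=; first by rewrite IH.
- congr TIn; rewrite -map_comp -[RHS]map_id; apply: eq_In_map => -[l [U V]] hin /=.
  by have [-> ->] := IH _ _ _ hin.
- congr TOut; rewrite -map_comp -[RHS]map_id; apply: eq_In_map => -[l [U V]] hin /=.
  by have [-> ->] := IH _ _ _ hin.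
Qed.

Definition hole_of (bs : seq (nat * (sty * sty))) : nat := choice.pickle (sty_tree (TOut bs)).

Definition selection (n : nat) : seq (nat * (sty * sty)) :=
  if choice.unpickle n is Some t then
    if tree_sty t is TOut bs then bs else [::]
  else [::].

Lemma hole_ofK : cancel hole_of selection.
Proof. by move=> bs; rewrite /selection choice.pickleK sty_treeK. Qed.

Definition lookup l (bs : seq (nat * (sty * sty))) : sty * sty :=
  if [seq b.2 | b <- bs & b.1 == l] is b :: _ then b else (TEnd, TEnd).

Lemma lookupE l b bs : uniq (map fst bs) -> List.In (l, b) bs -> lookup l bs = b.
Proof.
rewrite /lookup => un hin.
have [b' hb'] : exists b', List.In (l, b') bs /\
    (if [seq b.2 | b <- bs & b.1 == l] is b :: _ then b else (TEnd, TEnd)) = b'.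
  elim: bs hin {un} => //= -[m c] bs IH; case: eqP => /= [-> _|ne].
    by exists c; split=> //; left.
  by case=> [[/ne]//|/IH[b' [? ?]]]; exists b'; split=> //; right.
by case: hb' => hin' ->; apply: uniq_In hin' hin.
Qed.

Definition coded_fill A := fill A (fun n => TOut (selection n)).

(* A is read off the tree of S; a hole is numbered by a code of its selection, so
   that one numbering serves all the selections in S. *)
Lemma oext_actx l P S S' : wf S -> oext l P S S' ->
  exists A, [/\ teq S (coded_fill A),
    in_actx A = (if unf S is TIn _ then true else false) &
    forall m Q S1, oext m Q S S1 ->
      S1 = fill A (fun n => (lookup m (selection n)).2) /\
      (forall n, n \in holes A ->
         List.In (m, lookup m (selection n)) (selection n) /\
         Q (lookup m (selection n)).1)].
Proof.
move=> wS h; elim: h wS => {S S'} [S bs S0 T0 e _ _|S bs g e _ IH] wS.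
  exists (AHole (hole_of bs)); split=> [| |m Q S1 o]; first last.
  - have [_ un _] := wf_unfOut wS e.
    case: o => [bs1 U V e1 hin QU|]; last by move=> ? ?; rewrite e.
    move: hin; have -> : bs1 = bs by congruence.
    move=> hin; rewrite /= hole_ofK (lookupE un hin); split=> // n.
    by rewrite inE => /eqP ->; rewrite hole_ofK (lookupE un hin).
  - by rewrite e.
  by apply: teq_unf => //; rewrite /coded_fill /= ?hole_ofK //;
    rewrite -e; apply: wf_unf.
have w := wf_unfIn wS e; have [_ un wb] := w.
pose Q (m : nat) (U V : sty) A := teq V (coded_fill A) /\
    forall m Q S1, oext m Q V S1 ->
      S1 = fill A (fun n => (lookup m (selection n)).2) /\
      (forall n, n \in holes A ->
         List.In (m, lookup m (selection n)) (selection n) /\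
         Q (lookup m (selection n)).1).
have [m U V hin|f hf] := @branch_choice _ (AHole 0) bs Q un.
  have [_ wV] := wb _ _ _ hin; have [A [? _ ?]] := IH _ _ _ hin wV.
  by exists A.
exists (AIn (relabel f bs)); split=> [| |m P1 S1 o]; first last.
- case: o => [bs1 U V|bs1 g1 e1 o1]; first by rewrite e.
  have ? : bs1 = bs by congruence.
  subst bs1; split.
    rewrite /= -map_comp; congr TIn; apply: eq_In_map => -[l' [U V]] hin /=.
    by have [_ /(_ _ _ _ (o1 _ _ _ hin)) [-> _]] := hf _ _ _ hin.
  move=> n /flattenP[s /In_mem/In_map[[l' [U A]] /In_relabel[[V hin] ->] <-] hn].
  by have [_ /(_ _ _ _ (o1 _ _ _ hin)) [_ /(_ n hn)]] := hf _ _ _ hin.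
- by rewrite e.
have -> : coded_fill (AIn (relabel f bs)) = TIn (relabel (fun l => coded_fill (f l)) bs).
  by rewrite /coded_fill /= -map_comp; congr TIn; apply: eq_In_map => -[l' [U V]].
by apply: teq_relabelIn e _ => // l' U V /hf [].
Qed.

Lemma le_a_step_of_tree R T S : wf T -> wf S -> le_a_tree_step R T S -> le_a_step R T S.
Proof.
move=> wT wS [|[bs [bs' [e e' h]]]]; first exact: LeSync.
have [ne _ _] := wf_unfOut wT e.
(* Choices are nonempty, and the context obtained from any one label of T serves all of them. *)
have [l0 [U0 [V0 h0]]] : exists l U V, List.In (l, (U, V)) bs.
  by case: bs ne {e h} => // -[l [U V]] bs _; exists l, U, V; left.
have [_ [S0 o0 _]] := h _ _ _ h0.
have [A [tA inA hA]] := oext_actx wS o0.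
apply: LeAsync e tA _ _; first by rewrite inA e'.
move=> l U V /h [hV [S1 /hA [-> hn] rV]]; split=> //.
exists (fun n => (lookup l (selection n)).1), (fun n => (lookup l (selection n)).2).
by split=> // n /hn [hin ?]; split=> //; move: hin; case: (lookup _ _).
Qed.

(** * Transitivity of asynchronous subtyping *)

Lemma le_a_sync T S : wf T -> wf S -> le_s_step le_a T S -> le_a T S.
Proof. by move=> wT wS h; apply: (largest_fold mono_le_a_step) => //; apply: LeSync. Qed.

Lemma teq_le_a T S : teq T S -> le_a T S.
Proof.
apply: largest_coind => {}T {}S /teqE [? ? st]; split=> //; apply: LeSync.
by apply: le_s_step_of_teq st; apply: teq_sym.
Qed.

(** Supplies the side condition of delayed outputs in transitivity. Where T <= S is itself delayed,
    the condition is among the premises; otherwise the induction on the tree of S proceeds. *)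
Lemma le_a_has_in T S : le_a T S -> has_in S -> has_in T.
Proof.
move=> lTS; have [_ wS _] := le_aE lTS; move/(has_in_tree wS) => h.
elim: h T lTS {wS} => [{}S bs e|{}S bs e _ IH] T lTS;
  have [wT wS _] := le_aE lTS; case: (le_a_tree lTS).
- case=> [_|bs1 bs2 e1 _ _|bs1 bs2 _]; try by rewrite e.
  exact: has_in_In e1.
- case=> bs1 [bs2 [e1 _ h]]; apply/(has_in_OutP wT e1) => l U V /h.
  by case.
- case=> [_|bs1 bs2 _|bs1 bs2 e1 e2 h]; try by rewrite e.
  apply/(has_in_OutP wT e1) => l U V /h [U' [V' [hin _ lV]]].
  by apply: (IH l U' V') lV; move: e2 hin; rewrite e => -[->].
- case=> bs1 [bs2 [e1 _ h]]; apply/(has_in_OutP wT e1) => l U V /h.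
  by case.
Qed.

(** The key to transitivity. If S selects at its root, the supertype V offers the label at its root
    or after some inputs, by the definition of subtyping. If S begins with an input, then so does V,
    and the induction continues below. *)
Lemma le_a_oext l P S S' V : le_a S V -> oext l P S S' ->
  exists2 V', oext l (fun U => exists2 U', P U' & le_a U U') V V' & le_a S' V'.
Proof.
move=> lSV o; elim: o V lSV => {S S'} [S bs S0 T0 e hin PS|S bs g e o IH] V lSV.
  have [wS wV _] := le_aE lSV; case: (le_a_tree lSV).
    case=> [|bs1 bs2|bs1 bs2 e1 e2 h]; try by rewrite e.
    have [|U [W [hin' lU lW]]] := h l S0 T0.
      by move: e1 hin; rewrite e => -[->].
    by exists W => //; apply: OextOut e2 hin' _; exists S0.
  case=> bs1 [bs2 [e1 e2 h]]; have [|_ [V' o lV']] := h l S0 T0.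
    by move: e1 hin; rewrite e => -[->].
  by exists V' => //; apply: oext_mono o => U lU; exists S0.
have [wS wV _] := le_aE lSV; case: (le_a_tree lSV); last first.
  by case=> ? [? []]; rewrite e.
case=> [|bs1 bs2 e1 e2 h|bs1 bs2]; try by rewrite e.
have ? : bs1 = bs by congruence.
subst bs1; have w2 := wf_unfIn wV e2; have [_ un2 wb2] := w2.
pose Q (m : nat) (U W x : sty) :=
  oext l (fun U => exists2 U', P U' & le_a U U') W x /\ le_a (g m) x.
have [m U W /h [U' [W' [hin' lU lW]]]|f hf] := @branch_choice _ TEnd bs2 Q un2.
  by have [x] := IH _ _ _ hin' _ lW; exists x.
exists (TIn (relabel f bs2)).
  by apply: OextIn e2 _ => m U W /hf [].
apply: le_a_sync.
- by apply: wf_oext wS _; apply: OextIn e o.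
- by apply/wf_atIn/wf_relabel => // m U W /hf [_ /le_aE []].
apply: LeIn => // m U x /In_relabel [[W hin] ->].
have [U' [W' [hin' lU lW]]] := h _ _ _ hin.
exists U', (g m); split=> //; last by have [] := hf _ _ _ hin.
by apply/In_relabel; split=> //; exists W'.
Qed.

(** Two delayed steps never meet: the first makes S start with an input, the second with an output.
    In the remaining mixed cases, the extraction is either composed with a synchronous step on T or
    transported from S to V. *)
Lemma le_a_trans T S V : le_a T S -> le_a S V -> le_a T V.
Proof.
move=> h h'; apply: (@largest_coind _ (comp le_a le_a)); last by exists S.
move=> {h h'}T {}V [{}S lTS lSV]; have [wT wS _] := le_aE lTS; have [_ wV _] := le_aE lSV.
split=> //; apply: le_a_step_of_tree => //.
case: (le_a_tree lTS) (le_a_tree lSV) => [st [st'|]|].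
- by left; apply: le_s_step_comp st st'.
- case=> bs [bs' [e e' h]]; right.
  case: st => [_|bs1 bs2 _|bs1 bs2 e1 e2 h1]; try by rewrite e.
  exists bs1, bs'; split=> // l S0 T0 /h1 [S1 [T1 [hin lS lT]]].
  have [|hT1 [V' o lV']] := h l S1 T1.
    by move: e2 hin; rewrite e => -[->].
  split; first exact: le_a_has_in lT hT1.
  by exists V'; [apply: oext_mono o => U lU; exists S1|exists T1].
- case=> bs [bs' [e e' h]] [st'|[? [? []]]]; last by rewrite e'.
  case: st' => [|bs1 bs2 e1 e2 _|bs1 bs2]; try by rewrite e'.
  right; exists bs, bs2; split=> // l S0 T0 /h [hT0 [S' o lS']]; split=> //.
  have [V' o' lV'] := le_a_oext lSV o.
  exists V'; last by exists S'.
  by apply: oext_mono o' => U [U' ? ?]; exists U'.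
Qed.

(** * Typing with total environments *)

(** The interface common to both relations. The inversions are one-sided so as to hold
    asynchronously: an input on the left or an output on the right excludes a delayed output. *)
Record subtyping (le : sty -> sty -> Prop) : Prop := Subtyping {
  sub_wf : forall T S, le T S -> wf T /\ wf S;
  sub_teq : forall T S, teq T S -> le T S;
  sub_trans : forall T S V, le T S -> le S V -> le T V;
  sub_sync : forall T S, wf T -> wf S -> le_s_step le T S -> le T S;
  sub_End : forall T S, le T S -> unf T = TEnd -> unf S = TEnd;
  sub_In : forall T S bs, le T S -> unf T = TIn bs ->
    exists2 bs', unf S = TIn bs' & forall l S' T', List.In (l, (S', T')) bs' ->
      exists S0 T0, [/\ List.In (l, (S0, T0)) bs, le S0 S' & le T0 T'];
  sub_Out : forall T S bs', le T S -> unf S = TOut bs' ->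
    exists2 bs, unf T = TOut bs & forall l S0 T0, List.In (l, (S0, T0)) bs ->
      exists S' T', [/\ List.In (l, (S', T')) bs', le S' S0 & le T0 T']
}.

Lemma subtyping_le_s : subtyping le_s.
Proof.
split.
- by move=> T S /le_sE [].
- exact: teq_le_s.
- by move=> T S V; apply: le_s_trans.
- exact: (largest_fold mono_le_s_step).
- by move=> T S /le_sE [_ _ [//|b1 b2 e _ _|b1 b2 e _ _]]; rewrite e.
- move=> T S bs /le_sE [_ _ [e|b1 b2 e e' h|b1 b2 e]]; try by rewrite e.
  by rewrite e => -[<-]; exists b2.
- move=> T S bs /le_sE [_ _ [_ e|b1 b2 _ e|b1 b2 e e' h]]; try by rewrite e.
  by rewrite e' => -[<-]; exists b1.
Qed.

Lemma subtyping_le_a : subtyping le_a.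
Proof.
split.
- by move=> T S /le_aE [].
- exact: teq_le_a.
- by move=> T S V; apply: le_a_trans.
- exact: le_a_sync.
- move=> T S /le_a_tree [[//|b1 b2 e _ _|b1 b2 e _ _]|[b1 [b2 [e _ _]]]]; by rewrite e.
- move=> T S bs /le_a_tree [[e|b1 b2 e e' h|b1 b2 e]|[b1 [b2 [e _ _]]]]; try by rewrite e.
  by rewrite e => -[<-]; exists b2.
- move=> T S bs /le_a_tree [[_ e|b1 b2 _ e|b1 b2 e e' h]|[b1 [b2 [_ e _]]]]; try by rewrite e.
  by rewrite e' => -[<-]; exists b1.
Qed.

(** Absent identifiers get [TEnd], because [env_le] adds and drops entries that are tree equal to
    it. *)
Definition ev (D : env) : ident -> sty := fun u => odflt TEnd D.[? u].

Definition upd (E : ident -> sty) u T : ident -> sty :=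
  fun v => if v == u then T else E v.

Lemma ev_set D u T v : ev D.[u <- T] v = upd (ev D) u T v.
Proof. by rewrite /ev /upd fnd_set; case: eqP. Qed.

Lemma ev_notin (D : env) u : u \notin domf D -> ev D u = TEnd.
Proof. by move=> h; rewrite /ev not_fnd. Qed.

Lemma ev0 u : ev env0 u = TEnd.
Proof. by rewrite /ev fnd_fmap0. Qed.

(* A common weakening of both typing systems, with subsumption built into every
   rule.  Queues, which are all empty, are not recorded. *)
Inductive gtyp (le : sty -> sty -> Prop) : genv -> proc -> (ident -> sty) -> Prop :=
| GNil G E : (forall v, le TEnd (E v)) -> gtyp le G PNil E
| GQueue G b a E : (forall v, le TEnd (E v)) -> gtyp le G (PQueue b a [::]) E
| GCall (G : genv) (X : pvar) us Ts E :
    G.[? X] = Some Ts -> (forall v, le (ev (env_of us Ts) v) (E v)) ->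
    gtyp le G (PCall X us) E
| GIn G u (pbs : seq (label * (var * proc))) (tbs : seq (label * (sty * sty))) E0 E :
    wf (TIn tbs) -> map fst pbs = map fst tbs ->
    (forall l x P, List.In (l, (x, P)) pbs -> E0 (Var x) = TEnd) ->
    (forall l x P S T, List.In (l, (x, P)) pbs -> List.In (l, (S, T)) tbs ->
       gtyp le G P (upd (upd E0 u T) (Var x) S)) ->
    (forall v, le (upd E0 u (TIn tbs) v) (E v)) ->
    gtyp le G (PIn u pbs) E
| GOut G u l u' P E0 E S T :
    u != u' -> gtyp le G P (upd E0 u T) ->
    (forall v, le (upd (upd E0 u (TOut [:: (l, (S, T))])) u' S v) (E v)) ->
    gtyp le G (POut u l u' P) E
| GPar G P1 P2 E1 E2 E :
    gtyp le G P1 E1 -> gtyp le G P2 E2 ->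
    (forall v, (le (E1 v) (E v) /\ E2 v = TEnd) \/ (E1 v = TEnd /\ le (E2 v) (E v))) ->
    gtyp le G (PPar P1 P2) E
| GChoice G P1 P2 E :
    gtyp le G P1 E -> gtyp le G P2 E -> gtyp le G (PChoice P1 P2) E
| GDef (G : genv) (X : pvar) (xs : seq var) Ts P Q E :
    all wf Ts -> size xs = size Ts ->
    gtyp le G.[X <- Ts] P (ev (env_of (map Var xs) Ts)) ->
    gtyp le G.[X <- Ts] Q E ->
    gtyp le G (PDef X xs P Q) E
| GRes G a b P E0 E T1 T2 :
    E0 (Chan a) = TEnd -> E0 (Chan b) = TEnd -> a != b -> teq T2 (dual T1) ->
    gtyp le G P (upd (upd E0 (Chan a) T1) (Chan b) T2) ->
    (forall v, le (E0 v) (E v)) ->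
    gtyp le G (PRes a b P) E.

(** The hypothesis speaks of lower bounds so that neither transitivity nor reflexivity is required
    of [le]; it also covers pointwise equal environments without functional extensionality. *)
Lemma gtyp_weaken le G P E E' : gtyp le G P E ->
  (forall v T, le T (E v) -> le T (E' v)) -> gtyp le G P E'.
Proof.
move=> h; elim: h E' => {G P E}.
- by move=> G E h E' w; apply: GNil => v; apply: w.
- by move=> G b a E h E' w; apply: GQueue => v; apply: w.
- by move=> G X us Ts E e h E' w; apply: GCall e _ => v; apply: w.
- by move=> G u pbs tbs E0 E wt lab ne h _ hE E' w; apply: GIn wt lab ne h _ => v; apply: w.
- by move=> G u l u' P E0 E S T ne h _ hE E' w; apply: GOut ne h _ => v; apply: w.
- move=> G P1 P2 E1 E2 E h1 _ h2 _ hE E' w; apply: GPar h1 h2 _ => v.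
  by case: (hE v) => -[? ?]; [left|right]; split=> //; apply: w.
- by move=> G P1 P2 E _ h1 _ h2 E' w; apply: GChoice; [apply: h1|apply: h2].
- by move=> G X xs Ts P Q E ? ? h _ _ h' E' w; apply: GDef h _ => //; apply: h'.
- by move=> G a b P E0 E T1 T2 ea eb ne d h _ hE E' w; apply: GRes ea eb ne d h _ => v; apply: w.
Qed.

Lemma gtyp_ext le G P E E' : gtyp le G P E -> (forall v, E v = E' v) -> gtyp le G P E'.
Proof. by move=> h e; apply: gtyp_weaken h _ => v T; rewrite e. Qed.

(** Concerns channels and variables only. The body of a definition is skipped, being typed in the
    environment of its parameters; queues are empty in [gtyp] and mention no message. *)
Fixpoint no_free (v : ident) (P : proc) : bool :=
  match P with
  | PCall _ us => v \notin us
  | PIn u bs => (v != u) &&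
      all (fun b => let: (_, (x, P')) := b in (v == Var x) || no_free v P') bs
  | POut u _ u' P' => [&& v != u, v != u' & no_free v P']
  | PPar P1 P2 | PChoice P1 P2 => no_free v P1 && no_free v P2
  | PDef _ _ _ Q => no_free v Q
  | PRes a b P' => [|| v == Chan a, v == Chan b | no_free v P']
  | _ => true
  end.

Definition gwf (G : genv) := forall X Ts, G.[? X] = Some Ts -> all wf Ts.

Lemma gwf_set (G : genv) X Ts : gwf G -> all wf Ts -> gwf G.[X <- Ts].
Proof.
move=> gG wT Y Us; rewrite fnd_set; case: eqP => _; last exact: gG.
by case=> <-.
Qed.

Lemma gwf0 : gwf genv0.
Proof. by move=> X Ts; rewrite fnd_fmap0. Qed.

Lemma ev_env_of1 u T v : ev (env_of [:: u] [:: T]) v = upd (fun=> TEnd) u T v.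
Proof. by rewrite ev_set /upd ev0. Qed.

Lemma env_of_notin us Ts v : v \notin us -> ev (env_of us Ts) v = TEnd.
Proof.
rewrite /env_of; elim: us Ts => [|u us IH] [|T Ts] /=; rewrite ?ev0 //.
by rewrite in_cons negb_or ev_set /upd => /andP[/negPf -> /IH].
Qed.

Lemma wf_env_of us Ts v : all wf Ts -> wf (ev (env_of us Ts) v).
Proof.
rewrite /env_of; elim: us Ts => [|u us IH] [|T Ts] /=; rewrite ?ev0 //.
by move=> /andP[wT /IH w]; rewrite ev_set /upd; case: eqP.
Qed.

(** * Strengthening, and the typing rules read in total environments *)

Section Subtyping.
Variable le : sty -> sty -> Prop.
Hypothesis sub : subtyping le.

Let le_refl T : wf T -> le T T.
Proof. by move=> wT; apply: (sub_teq sub); apply: teq_refl. Qed.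

Lemma env_le_ev D D' v : (forall u, wf (ev D u)) -> env_le le D D' ->
  le (ev D v) (ev D' v).
Proof.
move=> w /(_ v); move: (w v); rewrite /ev.
case: D.[? v] => [T|]; case: D'.[? v] => [T'|] //= wT.
- exact: (sub_teq sub).
- by move/teq_sym; apply: (sub_teq sub).
- by move=> _; apply: le_refl.
Qed.

Lemma env_le_wf D D' : (forall u, wf (ev D u)) -> env_le le D D' ->
  forall u, wf (ev D' u).
Proof. by move=> w l u; case: (sub_wf sub (env_le_ev u w l)). Qed.

(** Linearity: a type other than a supertype of [end] has to be consumed by an occurrence of the
    identifier. *)
Lemma no_free_end G P E v : gtyp le G P E -> no_free v P -> le TEnd (E v).
Proof.
have trans := sub_trans sub.
move=> h; elim: h => {G P E} //=.
- move=> G X us Ts E _ h vus; apply: trans (h v).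
  by rewrite env_of_notin //; apply: le_refl.
- move=> G u pbs tbs E0 E wt lab xE _ IH hE /andP[vu /all_In hv].
  have /wf_atIn [ne _ _] := wt.
  have [l [[U V] hin]] : exists l b, List.In (l, b) tbs.
    by case: tbs ne {wt lab IH hE} => // -[l b] tbs _; exists l, b; left.
  have [|[x P] hin'] := @label_In _ pbs l; first by rewrite lab (In_label hin).
  move: (hE v) (IH _ _ _ _ _ hin' hin) (hv _ hin'); rewrite /upd (negPf vu) => hEv.
  (* If v is the variable bound by the input, [E0] already gives it [TEnd]. *)
  case: eqP => [ev _ _|_ h /= /h h']; last exact: trans hEv.
  by rewrite ev (xE _ _ _ hin') -ev in hEv.
- move=> G u l u' P E0 E S T _ _ IH hE /and3P[vu vu' /IH].
  by move: (hE v); rewrite /upd (negPf vu) (negPf vu') => h h'; apply: trans h.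
- move=> G P1 P2 E1 E2 E _ IH1 _ IH2 hE /andP[/IH1 h1 /IH2 h2].
  by case: (hE v) => -[h h']; [apply: trans h|apply: trans h'].
- by move=> G P1 P2 E _ IH _ _ /andP[/IH].
- move=> G a b P E0 E T1 T2 ea eb ab _ _ IH hE.
  move: (hE v) IH; rewrite /upd; case: (v =P Chan b) => [->|_].
    by rewrite eb.
  case: (v =P Chan a) => [->|_ /= h IH /IH h']; first by rewrite ea.
  exact: trans h.
Qed.

(** The rule does not reveal which component receives v. If v is not free in Q and is given to Q all
    the same, then its type there is a supertype of [end], which P has at v, so the inequality holds
    in either case. *)
Lemma gtyp_par G P Q E : gtyp le G (PPar P Q) E ->
  exists E1 E2, [/\ gtyp le G P E1, gtyp le G Q E2,
    forall v, no_free v Q -> le (E1 v) (E v) &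
    forall v, no_free v P -> le (E2 v) (E v)].
Proof.
have trans := sub_trans sub.
move=> h; inversion h as [| | | | |? ? ? E1 E2 ? h1 h2 hE| | |]; subst.
exists E1, E2; split=> // v.
  move=> /(no_free_end h2) h'; case: (hE v) => [[]//|[-> h'']].
  exact: trans h''.
move=> /(no_free_end h1) h'; case: (hE v) => [[h'' ->]|[]//].
exact: trans h''.
Qed.

(** Well-formedness is carried along because [le] is reflexive on closed, contractive types only,
    and every rule of [gtyp] contains a subsumption. *)
Definition wf_typ G P D := gtyp le G P (ev D) /\ forall u, wf (ev D u).

Lemma wf_typ_sub G P D D' : wf_typ G P D -> env_le le D D' -> wf_typ G P D'.
Proof.
move=> [gP w] lD; split; last exact: env_le_wf lD.
by apply: gtyp_weaken gP _ => v T h; apply: (sub_trans sub) h (env_le_ev v w lD).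
Qed.

Lemma wf_typ_nil G : wf_typ G PNil env0.
Proof.
by split=> [|u]; [apply: GNil => v|]; rewrite ev0 //; apply: le_refl.
Qed.

Lemma wf_typ_queue G b a : wf_typ G (PQueue b a [::]) env0.
Proof.
by split=> [|u]; [apply: GQueue => v|]; rewrite ev0 //; apply: le_refl.
Qed.

Lemma wf_typ_call (G : genv) (X : pvar) us Ts :
  G.[? X] = Some Ts -> gwf G -> wf_typ G (PCall X us) (env_of us Ts).
Proof.
move=> e /(_ _ _ e) wT; split; last by move=> u; apply: wf_env_of.
by apply: GCall e _ => v; apply: le_refl; apply: wf_env_of.
Qed.

Lemma ex_In_branches (A : Type) (pbs : seq (nat * A)) tbs :
  wf_branches 0 tbs -> map fst pbs = map fst tbs ->
  exists l b U V, List.In (l, b) pbs /\ List.In (l, (U, V)) tbs.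
Proof.
case: tbs => [[]//|[l [U V]] tbs] _ lab.
have [|b hin] := @label_In _ pbs l; first by rewrite lab inE eqxx.
by exists l, b, U, V; split=> //; left.
Qed.

Lemma wf_typ_in G u (pbs : seq (nat * (nat * proc))) tbs (D : env) :
  wf (TIn tbs) -> map fst pbs = map fst tbs ->
  (forall l x P, List.In (l, (x, P)) pbs -> Var x != u /\ Var x \notin domf D) ->
  (forall l x P S T, List.In (l, (x, P)) pbs -> List.In (l, (S, T)) tbs ->
     wf_typ G P D.[u <- T].[Var x <- S]) ->
  wf_typ G (PIn u pbs) D.[u <- TIn tbs].
Proof.
move=> wt lab xD h.
have w v : wf (ev D.[u <- TIn tbs] v).
  (* Some branch exists, and its premise shows that the types in [D] are well-formed. *)
  have [l [[x P] [U [V [hin hin']]]]] := ex_In_branches ((wf_atIn 0 tbs).1 wt) lab.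
  have [_ /(_ v)] := h _ _ _ _ _ hin hin'.
  rewrite !ev_set /upd ev_set /upd; case: (v =P u) => // _.
  by case: eqP => // -> _; rewrite ev_notin //; case: (xD _ _ _ hin).
split=> //; apply: (@GIn _ _ _ _ tbs (ev D)) => //.
- by move=> l x P /xD [_ ?]; rewrite ev_notin.
- move=> l x P U V hin hin'; have [g _] := h _ _ _ _ _ hin hin'.
  by apply: gtyp_ext g _ => v; rewrite ev_set /upd ev_set.
- by move=> v; rewrite -ev_set; apply: le_refl.
Qed.

Lemma wf_typ_out G u l u' P (D : env) S T :
  wf S -> u != u' -> wf_typ G P D.[u <- T] ->
  wf_typ G (POut u l u' P) D.[u <- TOut [:: (l, (S, T))]].[u' <- S].
Proof.
move=> wS uu' [gP w].
have w' v : wf (ev D.[u <- TOut [:: (l, (S, T))]].[u' <- S] v).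
  rewrite ev_set /upd; case: eqP => // _; rewrite ev_set /upd.
  case: eqP => [_|/eqP vu]; last by move: (w v); rewrite ev_set /upd (negPf vu).
  move: (w u); rewrite ev_set /upd eqxx => wT.
  by apply/wf_atOut; split=> // l' U V [[_ <- <-]|].
split=> //; apply: (@GOut _ _ _ _ _ _ (ev D) _ S T) => //.
  by apply: gtyp_ext gP _ => v; rewrite ev_set.
by move=> v; have := le_refl (w' v); rewrite [in X in le X _]ev_set /upd ev_set.
Qed.

Lemma wf_typ_par G P1 P2 (D1 D2 : env) : [disjoint domf D1 & domf D2] ->
  wf_typ G P1 D1 -> wf_typ G P2 D2 -> wf_typ G (PPar P1 P2) (D1 + D2).
Proof.
move=> dis [g1 w1] [g2 w2].
have e v : ev (D1 + D2) v = if v \in domf D2 then ev D2 v else ev D1 v.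
  by rewrite /ev fnd_cat; case: ifP.
split=> [|v]; last by rewrite e; case: ifP.
apply: GPar g1 g2 _ => v; rewrite e; case: ifP => v2.
  right; split; last exact: le_refl.
  by apply: ev_notin; apply: (fdisjointP_sym dis).
left; split; first exact: le_refl.
by apply: ev_notin; rewrite v2.
Qed.

Lemma wf_typ_choice G P1 P2 D :
  wf_typ G P1 D -> wf_typ G P2 D -> wf_typ G (PChoice P1 P2) D.
Proof. by move=> [g1 w1] [g2 w2]; split=> //; apply: GChoice. Qed.

Lemma wf_typ_def (G : genv) (X : pvar) (xs : seq var) Ts P Q D :
  all wf Ts -> size xs = size Ts ->
  wf_typ G.[X <- Ts] P (env_of (map Var xs) Ts) -> wf_typ G.[X <- Ts] Q D ->
  wf_typ G (PDef X xs P Q) D.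
Proof. by move=> wT sz [g1 w1] [g2 w2]; split=> //; apply: GDef g1 g2. Qed.

(** Duality is allowed to depend on well-formedness: asynchronously it comes from [remainder_nil],
    which assumes it. *)
Lemma wf_typ_res G a b P (D : env) T1 T2 :
  Chan a \notin domf D -> Chan b \notin domf D -> a != b ->
  (wf T1 -> wf T2 -> teq T2 (dual T1)) ->
  wf_typ G P D.[Chan a <- T1].[Chan b <- T2] -> wf_typ G (PRes a b P) D.
Proof.
move=> aD bD ab d [gP w].
have wD v : wf (ev D v).
  case: (v =P Chan a) => [->|/eqP va]; first by rewrite ev_notin.
  case: (v =P Chan b) => [->|/eqP vb]; first by rewrite ev_notin.
  by move: (w v); rewrite ev_set /upd (negPf vb) ev_set /upd (negPf va).
split=> //.
apply: (@GRes _ _ _ _ _ (ev D) _ T1 T2); rewrite ?ev_notin //.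
- apply: d; last by have := w (Chan b); rewrite ev_set /upd eqxx.
  have := w (Chan a); rewrite ev_set /upd ev_set /upd eqxx; case: eqP => // -[e].
  by rewrite e eqxx in ab.
- by apply: gtyp_ext gP _ => v; rewrite ev_set /upd ev_set.
- by move=> v; apply: le_refl.
Qed.

End Subtyping.

(** * Embedding of the two typing systems *)

Lemma typ_s_gtyp G P D : typ_s G P D -> gwf G -> wf_typ le_s G P D.
Proof.
have sub := subtyping_le_s => h; elim: h => {G P D}.
- by move=> G P D D' _ IH lD /IH h; apply: (wf_typ_sub sub) h lD.
- by move=> G _; apply: (wf_typ_nil sub).
- by move=> G X us Ts e _ _; apply: (wf_typ_call sub).
- move=> G u pbs tbs D wt lab uD xD _ IH gG; apply: (wf_typ_in sub) => //.
  by move=> l x P S T hin hin'; apply: IH hin hin' gG.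
- by move=> G u l u' P D S T wS _ _ uu' _ IH /IH; apply: (wf_typ_out sub).
- by move=> G P1 P2 D1 D2 dis _ IH1 _ IH2 gG; apply: (wf_typ_par sub) dis (IH1 gG) (IH2 gG).
- by move=> G P1 P2 D _ IH1 _ IH2 gG; apply: wf_typ_choice (IH1 gG) (IH2 gG).
- move=> G X xs Ts P Q D wT sz _ _ IH1 _ IH2 gG.
  have gG' := @gwf_set _ X _ gG wT.
  exact: wf_typ_def wT sz (IH1 gG') (IH2 gG').
- move=> G a b P D T aD bD ab _ IH /IH; apply: (wf_typ_res sub) => // wT wT'.
  exact: teq_refl.
Qed.

Fixpoint empty_queues (P : proc) : bool :=
  match P with
  | PIn _ bs => all (fun b => let: (_, (_, P')) := b in empty_queues P') bs
  | POut _ _ _ P1 | PRes _ _ P1 => empty_queues P1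
  | PPar P1 P2 | PChoice P1 P2 | PDef _ _ P1 P2 => empty_queues P1 && empty_queues P2
  | PQueue _ _ h => nilp h
  | _ => true
  end.

(** Even for an empty queue, [RemOut] may unfold T and rebuild its selections, so T is recovered
    only up to tree equality. *)
Lemma remainder_nil T T' : remainder T [::] T' -> wf T -> teq T T'.
Proof.
move e: [::] => tau h; elim: h e => {T T' tau}.
- by move=> T _; apply: teq_refl.
- by [].
- move=> T bs tau f e _ IH etau wT; apply: (teq_relabelOut (g := f)) => //.
  move=> l U V hin; apply: (IH _ _ _ hin etau).
  by have [_ _ w] := wf_unfOut wT e; case: (w _ _ _ hin).
Qed.

(** Emptiness of the recorded queue types belongs to the induction: it makes the remainders in the
    restriction rule trivial, so that the co-channels themselves have dual types. *)
Lemma typ_a_gtyp G P D Q : typ_a G P D Q -> gwf G -> empty_queues P ->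
  wf_typ le_a G P D /\ (forall p tau, Q.[? p] = Some tau -> tau = [::]).
Proof.
have sub := subtyping_le_a => h; elim: h => {G P D Q}.
- move=> G P D D' Q Q' _ IH lD eQ gG /(IH gG) [h hQ]; split.
    exact: (wf_typ_sub sub) h lD.
  move=> p tau e; move: (eQ p); rewrite e; case e': Q.[? p] => [tau'|] //.
  by rewrite (hQ _ _ e') => h'; inversion h'.
- by move=> G _ _; split=> [|p tau]; [apply: (wf_typ_nil sub)|rewrite fnd_fmap0].
- move=> G X us Ts e _ _ gG _; split; first exact: (wf_typ_call sub).
  by move=> p tau; rewrite fnd_fmap0.
- move=> G u pbs tbs D Q wt lab uD xD _ IH gG /all_In nq.
  have {}IH l x P S T : List.In (l, (x, P)) pbs -> List.In (l, (S, T)) tbs ->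
    wf_typ le_a G P D.[u <- T].[Var x <- S] /\
    (forall p tau, Q.[? p] = Some tau -> tau = [::]).
    by move=> hin hin'; exact: (IH _ _ _ _ _ hin hin' gG (nq _ hin)).
  split.
    apply: (wf_typ_in sub) => // l x P S T hin hin'.
    by case: (IH _ _ _ _ _ hin hin').
  have [l [[x P] [U [V [hin hin']]]]] := ex_In_branches ((wf_atIn 0 tbs).1 wt) lab.
  by case: (IH _ _ _ _ _ hin hin').
- move=> G u l u' P D Q S T wS _ _ uu' _ IH gG /(IH gG) [h hQ]; split=> //.
  exact: (wf_typ_out sub).
- move=> G P1 P2 D1 D2 Q1 Q2 dis _ _ IH1 _ IH2 gG /andP[/(IH1 gG)[h1 hQ1] /(IH2 gG)[h2 hQ2]].
  split; first exact: (wf_typ_par sub).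
  by move=> p tau; rewrite fnd_cat; case: ifP => _; [apply: hQ2|apply: hQ1].
- move=> G P1 P2 D Q _ IH1 _ IH2 gG /andP[/(IH1 gG)[h1 hQ1] /(IH2 gG)[h2 hQ2]].
  by split=> //; apply: wf_typ_choice.
- move=> G X xs Ts P P' D Q wT sz _ _ IH1 _ IH2 gG.
  have gG' := @gwf_set _ X _ gG wT.
  case/andP=> /(IH1 gG')[h1 _] /(IH2 gG')[h2 hQ]; split=> //.
  exact: wf_typ_def wT sz h1 h2.
- move=> G a b P D Q T1 T2 tau1 tau2 T1' T2' aD bD ab baQ abQ r1 r2 t _ IH gG /(IH gG) [h hQ].
  split; last first.
    move=> p tau e; apply: (hQ p); rewrite !fnd_set.
    case: eqP => [ep|_]; first by move: e abQ; rewrite ep; case: fndP.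
    by case: eqP => [ep|_ //]; move: e baQ; rewrite ep; case: fndP.
  have e2 : tau2 = [::] by apply: (hQ (a, b)); rewrite fnd_set eqxx.
  have e1 : tau1 = [::].
    apply: (hQ (b, a)); rewrite fnd_set; case: eqP => [[e _]|_]; last by rewrite fnd_set eqxx.
    by rewrite e eqxx in ab.
  subst tau1 tau2; apply: (wf_typ_res sub) h => // w1 w2.
  apply: teq_trans (remainder_nil r2 w2) (teq_trans t _).
  by apply: teq_dual; apply: teq_sym; apply: remainder_nil r1 w1.
- move=> G b a _ _; split; first exact: (wf_typ_queue sub).
  by move=> p tau; rewrite fnd_set; case: eqP => _; [case|rewrite fnd_fmap0].
- by move=> G b a h l c D Q S tau _ _ _ _ _ _; rewrite /= /nilp size_rcons.
Qed.

(** * Characteristic processes *)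

(** A characteristic process on u has no other free identifier, so bound names only have to avoid
    u. *)
Definition fresh_var (u : ident) : nat := if u is Var 0 then 1 else 0.
Definition fresh_chan (u : ident) : nat := if u is Chan m then m.+1 else 0.

Lemma fresh_varP u : Var (fresh_var u) != u.
Proof. by case: u => // -[]. Qed.

Lemma fresh_chanP u : (Chan (fresh_chan u) != u) * (Chan (fresh_chan u).+1 != u).
Proof.
case: u => // m /=; split; apply/eqP => -[] e; have := leqnn m.
  by rewrite -{1}e ltnn.
by rewrite -{1}e ltnNge leqnSn.
Qed.

(** Singletons are a separate case because a final [PNil] would force the common environment to
    consist of supertypes of [end]. *)
Fixpoint pchoice (Ps : seq proc) : proc :=
  match Ps with
  | [::] => PNil
  | [:: P] => P
  | P :: Ps' => PChoice P (pchoice Ps')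
  end.

Definition dual_unless (p : bool) (T : sty) : sty := if p then T else dual T.

Section CharacteristicProcess.
(* What accompanies a restriction: the two empty queues, in the asynchronous case. *)
Variable Z : chan -> chan -> proc.

Definition new (c d : chan) (P : proc) : proc := PRes c d (PPar P (Z c d)).

(** [kc] continues on u, while [km] checks the received channel. *)
Definition char_in (u : ident) (bs : seq (nat * (sty * sty)))
    (kc : sty -> proc) (km : ident -> sty -> proc) : proc :=
  PIn u (map (fun b => let: (l, (U, V)) := b in
    (l, (fresh_var u, PPar (kc V) (km (Var (fresh_var u)) U)))) bs).

(** One end of a fresh pair is sent and [km] checks the other. The internal choice forces a type of
    u to admit every label. *)
Definition char_out (u : ident) (bs : seq (nat * (sty * sty)))
    (kc : sty -> proc) (km : ident -> sty -> proc) : proc :=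
  pchoice (map (fun b => let: (l, (U, V)) := b in
    new (fresh_chan u) (fresh_chan u).+1
      (POut u l (Chan (fresh_chan u))
         (PPar (kc V) (km (Chan (fresh_chan u).+1) U)))) bs).

(* The characteristic process of T on u, or of its dual when p is false; the
   variables 0, ..., n - 1 of T are bound to the process variables n - 1, ..., 0. *)
Fixpoint char_proc (p : bool) (n : nat) (u : ident) (T : sty) {struct T} : proc :=
  match T with
  | TEnd => PNil
  | TVar j => PCall (n - j.+1) [:: u]
  | TMu T' => PDef n [:: 0] (char_proc p n.+1 (Var 0) T') (PCall n [:: u])
  | TIn bs =>
      if p then char_in u bs (fun V => char_proc p n u V) (fun v U => char_proc true 0 v U)
      else char_out u bs (fun V => char_proc p n u V) (fun v U => char_proc false 0 v U)
  | TOut bs =>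
      if p then char_out u bs (fun V => char_proc p n u V) (fun v U => char_proc false 0 v U)
      else char_in u bs (fun V => char_proc p n u V) (fun v U => char_proc true 0 v U)
  end.

Hypothesis no_free_Z : forall v c d, no_free v (Z c d).

Lemma no_free_pchoice v Ps : (forall P, List.In P Ps -> no_free v P) -> no_free v (pchoice Ps).
Proof.
elim: Ps => [|P [|Q Ps] IH] //= h; first by apply: h; left.
by rewrite h /=; [apply: IH => R hR; apply: h; right|left].
Qed.

Lemma no_free_char_in v u bs kc km :
  v != u ->
  (forall l U V, List.In (l, (U, V)) bs ->
     no_free v (kc V) /\ (forall w, v != w -> no_free v (km w U))) ->
  no_free v (char_in u bs kc km).
Proof.
move=> vu h; rewrite /= vu; apply/all_In => _ /In_map [[l [U V]] hin <-].
have [hV hU] := h _ _ _ hin.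
by case: eqP => //= /eqP vx; rewrite hV hU.
Qed.

Lemma no_free_char_out v u bs kc km :
  v != u ->
  (forall l U V, List.In (l, (U, V)) bs ->
     no_free v (kc V) /\ (forall w, v != w -> no_free v (km w U))) ->
  no_free v (char_out u bs kc km).
Proof.
move=> vu h; apply: no_free_pchoice => _ /In_map [[l [U V]] hin <-] /=.
have [hV hU] := h _ _ _ hin.
by case: eqP => //= /eqP vc; case: eqP => //= /eqP vd; rewrite vu hV hU // no_free_Z.
Qed.

Lemma no_free_char p n u T v : v != u -> no_free v (char_proc p n u T).
Proof.
elim/sty_nested_ind: T p n u => [|j|T IH|bs IH|bs IH] p n u vu /=.
- by [].
- by rewrite inE.
- by rewrite inE.
- case: p; [apply: no_free_char_in|apply: no_free_char_out] => // l U V hin;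
    by have [hU hV] := IH _ _ _ hin; split=> [|w]; [apply: hV|apply: hU].
- case: p; [apply: no_free_char_out|apply: no_free_char_in] => // l U V hin;
    by have [hU hV] := IH _ _ _ hin; split=> [|w]; [apply: hV|apply: hU].
Qed.

(** * Inversion of typings of characteristic processes *)

Section Inversion.
Variable le : sty -> sty -> Prop.
Hypothesis sub : subtyping le.
Let trans := sub_trans sub.
Let le_refl T : wf T -> le T T.
Proof. by move=> wT; apply: (sub_teq sub); apply: teq_refl. Qed.

Lemma gtyp_pchoice G Ps E : gtyp le G (pchoice Ps) E ->
  forall P, List.In P Ps -> gtyp le G P E.
Proof.
elim: Ps => [|P [|Q Ps] IH] //= h R; first by case=> // <-.
inversion h as [| | | | | |? ? ? ? h1 h2| |]; subst.
by case=> [<-//|]; apply: IH.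
Qed.

Lemma gtyp_call1 G X u E : gtyp le G (PCall X [:: u]) E ->
  forall T, G.[? X] = Some [:: T] -> le T (E u).
Proof.
move=> h T e; inversion h as [| |? ? ? Ts ? e' hE| | | | | |]; subst.
move: e' (hE u); rewrite e => -[<-].
by rewrite ev_env_of1 /upd eqxx.
Qed.

Lemma gtyp_def1 G X P Q E : gtyp le G (PDef X [:: 0] P Q) E ->
  exists T, [/\ wf T, gtyp le G.[X <- [:: T]] P (upd (fun=> TEnd) (Var 0) T)
    & gtyp le G.[X <- [:: T]] Q E].
Proof.
move=> h; inversion h as [| | | | | | |? ? ? Ts ? ? ? wT sz h1 h2|]; subst.
case: Ts wT sz h1 h2 {h} => [|T []] //= /andP[wT _] _ h1 h2; exists T; split=> //.
by apply: gtyp_ext h1 _ => v; rewrite -ev_env_of1.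
Qed.

Lemma gtyp_new G c d P E : gtyp le G (new c d P) E ->
  exists E0 T1, [/\ c != d, gtyp le G P E0, le (E0 (Chan c)) T1, le (E0 (Chan d)) (dual T1) &
    forall v, v != Chan c -> v != Chan d -> le (E0 v) (E v)].
Proof.
move=> h; inversion h as [| | | | | | | |? ? ? ? E1 ? T1 T2 ec ed cd t h1 hE]; subst.
have [E0 [E2 [hP _ h0 _]]] := gtyp_par sub h1.
have cd' : (Chan c == Chan d) = false by apply/eqP => -[e]; rewrite e eqxx in cd.
exists E0, T1; split=> //.
- by have := h0 (Chan c) (no_free_Z _ _ _); rewrite /upd eqxx cd'.
- have := h0 (Chan d) (no_free_Z _ _ _); rewrite /upd eqxx => h2.
  by apply: trans h2 (sub_teq sub t).
- move=> v vc vd; have := h0 v (no_free_Z _ _ _); rewrite /upd (negPf vc) (negPf vd) => h2.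
  exact: trans h2 (hE v).
Qed.

Lemma gtyp_out G u l u' P E : gtyp le G (POut u l u' P) E ->
  exists E0 S T, [/\ gtyp le G P E0, le (TOut [:: (l, (S, T))]) (E u), le S (E u'), E0 u = T
    & forall v, v != u -> v != u' -> le (E0 v) (E v)].
Proof.
move=> h; inversion h as [| | | |? ? ? ? ? E0 ? S T uu' h1 hE| | | |]; subst.
exists (upd E0 u T), S, T; split=> //.
- by have := hE u; rewrite /upd eqxx (negPf uu').
- by have := hE u'; rewrite /upd eqxx.
- by rewrite /upd eqxx.
- by move=> v vu vu'; have := hE v; rewrite /upd (negPf vu) (negPf vu').
Qed.

(** C is the type that the restriction gives to the channel sent; its partner, checked by [km], has
    the dual. This C becomes the upper bound demanded by [squeezed] for exchanged types. *)
Lemma gtyp_char_out G u bs kc km E :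
  (forall V v, v != u -> no_free v (kc V)) ->
  (forall U v w, v != w -> no_free v (km w U)) ->
  gtyp le G (char_out u bs kc km) E ->
  forall l U V, List.In (l, (U, V)) bs ->
  exists d S T C E1 E2, [/\ le (TOut [:: (l, (S, T))]) (E u), le S C,
    gtyp le G (kc V) E1 /\ le (E1 u) T & gtyp le G (km d U) E2 /\ le (E2 d) (dual C)].
Proof.
move=> nc nm /gtyp_pchoice h l U V hin.
have /gtyp_new [E0 [C [cd]]] := h _ ((In_map _ _ _).2 (ex_intro2 _ _ (l, (U, V)) hin erefl)).
case/gtyp_out=> E1 [S [T [h1 lu lc eT lE1]]] lC ld lE.
have [E2 [E3 [h2 h3 l2 l3]]] := gtyp_par sub h1.
have [cu du] := fresh_chanP u; rewrite eq_sym in cu; rewrite eq_sym in du.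
set c := fresh_chan u in h2 h3 l2 l3 cd cu du lE lE1 lc lC ld h1 *.
exists (Chan c.+1), S, T, C, E2, E3; split=> //.
- exact: trans lu (lE _ cu du).
- exact: trans lc lC.
- by split=> //; rewrite -eT; apply: l2; apply: nm.
- split=> //; apply: trans (l3 _ _) (trans (lE1 _ _ _) ld).
  + by apply: nc; rewrite eq_sym.
  + by rewrite eq_sym.
  + by apply/eqP => -[/eqP]; rewrite eq_sym ltn_eqF.
Qed.

Lemma gtyp_char_in G u bs kc km E :
  (forall V v, v != u -> no_free v (kc V)) ->
  (forall U v w, v != w -> no_free v (km w U)) ->
  gtyp le G (char_in u bs kc km) E ->
  exists tbs, [/\ le (TIn tbs) (E u), map fst bs = map fst tbs &
    forall l U V S T, List.In (l, (U, V)) bs -> List.In (l, (S, T)) tbs ->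
    exists x E1 E2, (gtyp le G (kc V) E1 /\ le (E1 u) T) /\
      (gtyp le G (km x U) E2 /\ le (E2 x) S)].
Proof.
move=> nc nm h; inversion h as [| | |? ? ? tbs E0 ? wt lab _ hP hE| | | | |]; subst.
exists tbs; split.
- by have := hE u; rewrite /upd eqxx.
- by rewrite -lab -map_comp; apply: eq_map => -[l [U V]].
move=> l U V S T hin hin'.
have h1 := hP _ _ _ _ _ ((In_map _ _ _).2 (ex_intro2 _ _ (l, (U, V)) hin erefl)) hin'.
have [E1 [E2 [h2 h3 l2 l3]]] := gtyp_par sub h1.
have xu := fresh_varP u; have ux : u != Var (fresh_var u) by rewrite eq_sym.
exists (Var (fresh_var u)), E1, E2; split; split=> //.
  by have := l2 _ (nm U _ _ ux); rewrite /upd (negPf ux) eqxx.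
by have := l3 _ (nc V _ xu); rewrite /upd eqxx.
Qed.

(* G binds the process variables of an open type T0 to derivations for the closed
   recursive types s that they stand for; then [msubst 0 s T0] is the closed type. *)
Inductive env_ok (p : bool) : nat -> seq sty -> genv -> Prop :=
| EnvOk0 G : env_ok p 0 [::] G
| EnvOkS n s (G : genv) T V : env_ok p n s G -> wf_at n (TMu T) -> wf V ->
    gtyp le G.[n <- [:: V]] (char_proc p n.+1 (Var 0) T) (upd (fun=> TEnd) (Var 0) V) ->
    env_ok p n.+1 (msubst 0 s (TMu T) :: s) G.[n <- [:: V]].

Lemma env_ok_wf p n s G : env_ok p n s G -> size s = n /\ all wf s.
Proof.
elim=> {n s G} // n s G T V _ [sz ws] wT wV _; split; first by rewrite /= sz.
by apply/andP; split=> //; apply: wf_msubst => //; rewrite sz.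
Qed.

(** A call leads back to the derivation stored for the body of its definition, together with the
    process environment valid there. This is how loops are unrolled. *)
Lemma env_ok_lookup p n s G j : env_ok p n s G -> j < n ->
  exists m s' G' T V, [/\ nth TEnd s j = msubst 0 s' (TMu T),
    env_ok p m.+1 (msubst 0 s' (TMu T) :: s') G', wf_at m (TMu T),
    gtyp le G' (char_proc p m.+1 (Var 0) T) (upd (fun=> TEnd) (Var 0) V) &
    G.[? n - j.+1] = Some [:: V]].
Proof.
move=> h; elim: h j => {n s G} // n s G T V h IH wT wV hT [_|j].
  exists n, s, G.[n <- [:: V]], T, V; split=> //; first exact: EnvOkS.
  by rewrite subn1 fnd_set eqxx.
rewrite ltnS => jn; have [m [s' [G' [T' [V' [e ok wT' hT' eV]]]]]] := IH _ jn.
exists m, s', G', T', V'; split=> //.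
by rewrite fnd_set subSS ltn_eqF // ltn_subrL (leq_ltn_trans (leq0n j) jn).
Qed.

(** T is presented as a closed instance of an open T0, since unrolling a definition leaves the
    characteristic process of such a subterm under the definitions in G. *)
Definition char_typ (p : bool) (T X : sty) : Prop :=
  wf X /\ exists n s G T0 u E, [/\ env_ok p n s G, wf_at n T0, T = msubst 0 s T0,
    gtyp le G (char_proc p n u T0) E & le (E u) X].

Lemma char_typ0 p G u T E X : wf T -> gtyp le G (char_proc p 0 u T) E -> le (E u) X ->
  char_typ p T X.
Proof.
move=> wT h l; split; first by case: (sub_wf sub l).
exists 0, [::], G, T, u, E; split=> //; first exact: EnvOk0.
by rewrite msubst_nil.
Qed.

Lemma char_typ_le p T X Y : char_typ p T X -> le X Y -> char_typ p T Y.
Proof.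
case=> _ [n [s [G [T0 [u [E [? ? ? ? l]]]]]]] lXY; split; first by case: (sub_wf sub lXY).
by exists n, s, G, T0, u, E; split=> //; apply: trans l lXY.
Qed.

Lemma char_typ_wf p T X : char_typ p T X -> wf T.
Proof.
case=> _ [n [s [G [T0 [u [E [/env_ok_wf [sz ws] wT -> _ _]]]]]]].
by apply: wf_msubst; rewrite ?sz.
Qed.

(** Calls and definitions are resolved until a prefix or the inactive process appears. Each
    resolution unfolds T once, so contractiveness ensures termination. *)
Lemma char_typ_unf p T X : char_typ p T X ->
  exists n s G T0 u E, [/\ env_ok p n s G, wf_at n T0, unf T = msubst 0 s T0,
    gtyp le G (char_proc p n u T0) E /\ le (E u) X &
    match T0 with TMu _ | TVar _ => False | _ => True end].
Proof.
have [m] := ubnP (mu_height T); elim: m T => // m IH T hm hT; have wT := char_typ_wf hT.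
(* Common to variables and recursive types: the process becomes the body of a definition, typed at
   its parameter with a type V below X. *)
have unrolled n s G T' V : env_ok p n.+1 (msubst 0 s (TMu T') :: s) G ->
    wf_at n (TMu T') -> T = msubst 0 s (TMu T') ->
    gtyp le G (char_proc p n.+1 (Var 0) T') (upd (fun=> TEnd) (Var 0) V) -> le V X ->
    exists n s G T0 u E, [/\ env_ok p n s G, wf_at n T0, unf T = msubst 0 s T0,
      gtyp le G (char_proc p n u T0) E /\ le (E u) X &
      match T0 with TMu _ | TVar _ => False | _ => True end].
  move=> ok wT' eT h l; have [_ /andP[_ ws]] := env_ok_wf ok.
  rewrite -unf_unfold1 //; apply: IH.
    by rewrite mu_height_unfold1 //; move: hm; rewrite eT.
  split; first by case: (sub_wf sub l).
  exists n.+1, (msubst 0 s (TMu T') :: s), G, T', (Var 0), (upd (fun=> TEnd) (Var 0) V).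
  split=> //; first by case/andP: wT'.
  by rewrite eT unfold1_msubst.
case: hT => _ [n [s [G [T0 [u [E [ok wT0 eT h l]]]]]]].
have unf_id : mu_height (msubst 0 s T0) = 0 -> unf T = msubst 0 s T0.
  by rewrite eT /unf => ->.
case: T0 eT wT0 h unf_id => [|j|T'|bs|bs] eT wT0 h unf_id.
- by exists n, s, G, TEnd, u, E; split=> //; apply: unf_id.
- have [m' [s' [G' [T' [V [e ok' wT' h' eV]]]]]] := env_ok_lookup ok wT0.
  apply: (unrolled m' s' G' T' V) => //.
    by rewrite eT /= subn0.
  exact: trans (gtyp_call1 h eV) l.
- have [V [wV h1 h2]] := gtyp_def1 h.
  apply: (unrolled n s G.[n <- [:: V]] T' V) => //; first exact: EnvOkS.
  by apply: trans l; apply: (gtyp_call1 h2); rewrite fnd_set eqxx.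
- by exists n, s, G, (TIn bs), u, E; split=> //; apply: unf_id.
- by exists n, s, G, (TOut bs), u, E; split=> //; apply: unf_id.
Qed.

Lemma char_typ_End p T X : char_typ p T X -> unf T = TEnd -> unf X = TEnd.
Proof.
move/char_typ_unf=> [n [s [G [T0 [u [E [ok w e [h l] sh]]]]]]]; rewrite e.
case: T0 w e h sh => //= _ _ h _ _.
inversion h as [? ? hE| | | | | | | |]; subst.
by apply: (sub_End sub (trans (hE u) l)).
Qed.

(** The case in which the process receives, which settles the root of X; the labels of X are then
    among those of T. *)
Lemma char_typ_In p T X bs : char_typ p T X -> unf T = (if p then TIn bs else TOut bs) ->
  exists2 xs, unf X = TIn xs & forall l S' T', List.In (l, (S', T')) xs ->
    exists S0 T0, [/\ List.In (l, (S0, T0)) bs, char_typ true S0 S' & char_typ p T0 T'].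
Proof.
move/char_typ_unf=> [n [s [G [T0 [u [E [ok w e [h l] sh]]]]]]]; rewrite e => e'.
have [bs0 [wb ebs {}h]] : exists bs0, [/\ wf_branches n bs0, bs = map_cont (msubst 0 s) bs0
   & gtyp le G (char_in u bs0 (fun V => char_proc p n u V) (fun v U => char_proc true 0 v U)) E].
  case: T0 w e h sh e' => //= [|bs0|bs0]; case: p {ok} => // w e h _.
    by case=> <-; exists bs0; split=> //; apply/wf_branchesP.
  by case=> <-; exists bs0; split=> //; apply/wf_branchesP.
have [tbs [lu lab hb]] := gtyp_char_in
  (fun V v => @no_free_char p n u V v) (fun U v w => @no_free_char true 0 w U v) h.
have [xs eX hX] := sub_In sub (trans lu l) erefl; exists xs => // m S' T' hin.
have [S1 [T1 [hin1 lS lT]]] := hX _ _ _ hin.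
have [|[U V] hin0] := @label_In _ bs0 m; first by rewrite lab (In_label hin1).
have [x [E1 [E2 [[h1 l1] [h2 l2]]]]] := hb _ _ _ _ _ hin0 hin1.
have [_ _ /(_ _ _ _ hin0) [wU wV]] := wb.
exists U, (msubst 0 s V); split.
- by rewrite ebs; apply/In_map_cont; exists V.
- exact: char_typ0 wU h2 (trans l2 lS).
- split; first by case: (sub_wf sub lT).
  by exists n, s, G, V, u, E1; split=> //; apply: trans l1 lT.
Qed.

(** The case in which the process sends. The conclusion retains an inequality because X may
    asynchronously begin with inputs that delay this output. *)
Lemma char_typ_Out p T X bs : char_typ p T X -> unf T = (if p then TOut bs else TIn bs) ->
  forall l S0 T0, List.In (l, (S0, T0)) bs ->
  exists S' T' C, [/\ le (TOut [:: (l, (S', T'))]) X, char_typ p T0 T', le S' C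
    & char_typ false S0 (dual C)].
Proof.
move/char_typ_unf=> [n [s [G [T0 [u [E [ok w e [h l] sh]]]]]]]; rewrite e => e'.
have [bs0 [wb ebs {}h]] : exists bs0, [/\ wf_branches n bs0, bs = map_cont (msubst 0 s) bs0
   & gtyp le G (char_out u bs0 (fun V => char_proc p n u V) (fun v U => char_proc false 0 v U)) E].
  case: T0 w e h sh e' => //= [|bs0|bs0]; case: p {ok} => // w e h _.
    by case=> <-; exists bs0; split=> //; apply/wf_branchesP.
  by case=> <-; exists bs0; split=> //; apply/wf_branchesP.
move=> m U V'; rewrite ebs => /In_map_cont [V hin <-].
have [d [S1 [T1 [C [E1 [E2 [lu lC [h1 l1] [h2 l2]]]]]]]] := gtyp_char_out
  (fun V v => @no_free_char p n u V v) (fun U v w => @no_free_char false 0 w U v) h hin.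
have [_ _ /(_ _ _ _ hin) [wU wV]] := wb.
exists S1, T1, C; split=> //.
- exact: trans lu l.
- split; first by case: (sub_wf sub l1).
  by exists n, s, G, V, u, E1; split.
- exact: char_typ0 wU h2 l2.
Qed.

(** X is bounded from below by the process of T and, through Y, from above by the process of its
    dual. *)
Definition squeezed (T X : sty) : Prop :=
  char_typ true T X /\ exists2 Y, le X Y & char_typ false T (dual Y).

Lemma dual_InE T bs : wf T -> unf (dual T) = TIn bs ->
  exists2 bs', unf T = TOut bs' & bs = map_cont dual bs'.
Proof.
by move=> wT; rewrite unf_dual //; case: (unf T) / (unfP wT) => // bs' _ [<-]; exists bs'.
Qed.

Lemma squeezed_teq T X : squeezed T X -> teq T X.
Proof.
apply: largest_coind => {}T {}X [hX [Y lXY hY]].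
have wT := char_typ_wf hX; have wX : wf X by case: hX.
have wY : wf Y by case: (sub_wf sub lXY).
split=> //; case eT: (unf T) / (unfP wT) => [|bs wb|bs wb].
- exact: TeqEnd eT (char_typ_End hX eT).
- have [xs eX hin] := char_typ_In hX eT.
  have [ys eY hle] := sub_In sub lXY eX.
  have hout := @char_typ_Out false _ _ _ hY eT.
  have [_ unb _] := wb; have [_ unx _] := wf_unfIn wX eX.
  (* The receiving process has made Y an input, so [dual Y] is a selection and [sub_Out] inverts the
     inequality of the sending process. *)
  have dY : unf (dual Y) = TOut (map_cont dual ys) by rewrite unf_dual // eY.
  have fwd l S T0 : List.In (l, (S, T0)) bs -> exists S' T', [/\ List.In (l, (S', T')) xs,
      squeezed S S' & squeezed T0 T'].
    move=> hb; have [S1 [T1 [C [l1 hT1 lC hC]]]] := hout _ _ _ hb.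
    have [bs1 e1 /(_ l S1 T1)] := sub_Out sub l1 dY.
    rewrite /unf /= in e1; case: e1 => <- /(_ (or_introl erefl)).
    case=> S2 [_ [/In_map_cont [T2 hy <-] lS2 lT1]].
    have [S3 [T3 [hx lS3 lT3]]] := hle _ _ _ hy.
    have [S4 [T4 [hb' hS hT]]] := hin _ _ _ hx.
    have [eS eT4] := uniq_In unb hb' hb; subst S4 T4.
    exists S3, T3; split=> //.
      (* The exchanged types are squeezed in turn, the upper bound being the type C of the channel
         sent. *)
      by split=> //; exists C => //; apply: trans lS3 (trans lS2 lC).
    by split=> //; exists T2 => //; apply: char_typ_le hT1 lT1.
  (* [fwd] finds some branch of X with this label, which is the given one as labels are distinct. *)
  apply: TeqIn eT eX _; split=> // l S' T' hx.
  have [S [T0 [hb _ _]]] := hin _ _ _ hx; exists S, T0.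
  have [S1 [T1 [hx1 ? ?]]] := fwd _ _ _ hb.
  by have [eS eT1] := uniq_In unx hx hx1; subst S' T'.
(* The receiving process is now that of the dual, so the root is found at Y and passed down to X. *)
- have [zs eD hin] := @char_typ_In false _ _ _ hY eT.
  have [ys eY ezs] := dual_InE wY eD; subst zs.
  have [xs eX hle] := sub_Out sub lXY eY.
  have hout := @char_typ_Out true _ _ _ hX eT.
  have [_ unb _] := wb; have [_ unx _] := wf_unfOut wX eX.
  have bwd l S' T' : List.In (l, (S', T')) xs -> exists S T0, [/\ List.In (l, (S, T0)) bs,
      squeezed S S' & squeezed T0 T'].
    move=> hx; have [S2 [T2 [hy lS2 lT2]]] := hle _ _ _ hx.
    have [|S [T0 [hb hS hT]]] := hin l S2 (dual T2).
      by apply/In_map_cont; exists T2.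
    have [S1 [T1 [C [l1 hT1 lC hC]]]] := hout _ _ _ hb.
    have [bs1 e1 /(_ l S1 T1)] := sub_Out sub l1 eX.
    rewrite /unf /= in e1; case: e1 => <- /(_ (or_introl erefl)).
    case=> S3 [T3 [hx3 lS3 lT3]].
    have [eS eT3] := uniq_In unx hx3 hx; subst S3 T3.
    exists S, T0; split=> //.
      split; first exact: char_typ_le hS lS2.
      by exists C => //; apply: trans lS3 lC.
    by split; [apply: char_typ_le hT1 lT3|exists T2].
  apply: (TeqOut eT eX); split=> // l S T0 hb.
  have [S1 [T1 [C [l1 _ _ _]]]] := hout _ _ _ hb.
  have [bs1 e1 /(_ l S1 T1)] := sub_Out sub l1 eX.
  rewrite /unf /= in e1; case: e1 => <- /(_ (or_introl erefl)).
  case=> S3 [T3 [hx _ _]]; exists S3, T3.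
  have [S4 [T4 [hb4 ? ?]]] := bwd _ _ _ hx.
  by have [eS eT4] := uniq_In unb hb4 hb; subst S4 T4.
Qed.

End Inversion.
End CharacteristicProcess.

(** * Test processes *)

Lemma set_env_comm (D : env) u v T S : u != v -> D.[u <- T].[v <- S] = D.[v <- S].[u <- T].
Proof.
by move=> uv; apply/fmapP => w; rewrite !fnd_set; case: (w =P v) => // ->;
  rewrite eq_sym (negPf uv).
Qed.

(* Sharing the definition of X between a and c, whose partner d behaves as the
   dual of T, bounds the type of X on both sides; [char_proc true 0 (Chan a) T]
   alone does not suffice in the asynchronous case: for T = mu t.!l.t it also has
   the type mu t.?m.!l.t, to which T is not related. *)
Definition test_proc (Z : chan -> chan -> proc) (a : nat) (T : sty) : proc :=
  PDef 0 [:: 0] (char_proc Z true 0 (Var 0) T)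
    (PPar (PCall 0 [:: Chan a])
       (new Z 0 1 (PPar (PCall 0 [:: Chan 0]) (char_proc Z false 0 (Chan 1) T)))).

Lemma test_procP Z le a T S : (forall v c d, no_free v (Z c d)) -> subtyping le -> wf T ->
  gtyp le genv0 (test_proc Z a T) (ev env0.[Chan a <- S]) -> le T S.
Proof.
move=> nfZ sub wT /(gtyp_def1) [W [wW hW hP]]; have trans := sub_trans sub.
have le_refl V : wf V -> le V V by move=> wV; apply: (sub_teq sub); apply: teq_refl.
have h1 : char_typ Z le true T W.
  by apply: (char_typ0 sub wT hW); rewrite /upd eqxx; apply: le_refl.
have eX : genv0.[0 <- [:: W]].[? 0] = Some [:: W] by rewrite fnd_set eqxx.
have [E1 [E2 [ha hnew la _]]] := gtyp_par sub hP.
have [E3 [Y [_ h3 lc ld _]]] := gtyp_new nfZ sub hnew.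
have [E4 [E5 [hc hd l4 l5]]] := gtyp_par sub h3.
have WY : le W Y.
  apply: trans (gtyp_call1 hc eX) (trans _ _ _ (l4 _ _) lc).
  exact: no_free_char.
have h2 : char_typ Z le false T (dual Y).
  by apply: (char_typ0 sub wT hd); apply: trans ld; apply: l5.
have tTW : teq T W by apply: (squeezed_teq nfZ sub); split=> //; exists Y.
apply: trans (sub_teq sub tTW) (trans _ _ _ (gtyp_call1 ha eX) _).
have := la (Chan a); rewrite ev_set /upd eqxx; apply.
(* The channel a may be 0 or 1; it is then bound by the restriction, hence still not free. *)
rewrite [no_free _ _]/= mem_seq1 nfZ andbT.
case: (Chan a =P Chan 0) => // _; case: (Chan a =P Chan 1) => // /eqP a1.
exact: no_free_char.
Qed.

(** * Guardedness and syntactic invariants of the test processes *)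

Section Positive.
Variable Z : chan -> chan -> proc.

Lemma guarded_in_char_out X u bs kc km : (forall X c d, guarded_in X (Z c d)) ->
  guarded_in X (char_out Z u bs kc km).
Proof.
move=> gZ; rewrite /char_out; set f := fun b => _; have : forall b, guarded_in X (f b).
  by move=> [l [U V]] /=.
by move=> hf; elim: bs => [|b [|b' bs] IH] //=; rewrite hf.
Qed.

(** Contractiveness of T becomes guardedness of the recursion; the process variable X stands for the
    type variable n - X.+1. *)
Lemma guarded_in_char T p n u X : (forall X c d, guarded_in X (Z c d)) ->
  wf_at n T -> X < n -> guarded (n - X.+1) T -> guarded_in X (char_proc Z p n u T).
Proof.
move=> gZ; elim: T p n u => [|j|T IH|bs|bs] p n u //=.
- move=> jn Xn; apply: contra => /eqP <-.
  by rewrite -subSn // subSS subKn // ltnW.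
- case/andP=> _ wT Xn; rewrite -subSn // => gT.
  by rewrite gtn_eqF //= andbT; apply: IH => //; apply: leqW.
- by move=> _ _ _; case: p => //; apply: guarded_in_char_out.
- by move=> _ _ _; case: p => //; apply: guarded_in_char_out.
Qed.

(** The test process and an outermost recursion of T both define the process variable 0; the inner
    definition shadows the outer one. *)
Lemma guarded_in_char0 T p u : (forall X c d, guarded_in X (Z c d)) ->
  wf T -> guarded_in 0 (char_proc Z p 0 u T).
Proof.
move=> gZ; case: T => [|j|T|bs|bs] //= _; first by case: p => //; apply: guarded_in_char_out.
by case: p => //; apply: guarded_in_char_out.
Qed.

Section Invariant.
Variable f : proc -> bool.
Hypothesis f_nil : f PNil.
Hypothesis f_call : forall X us, f (PCall X us).
Hypothesis f_in : forall u pbs, ~~ nilp pbs -> uniq (map fst pbs) ->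
  (forall l x P, List.In (l, (x, P)) pbs -> f P) -> f (PIn u pbs).
Hypothesis f_out : forall u l v P, f P -> f (POut u l v P).
Hypothesis f_par : forall P Q, f P -> f Q -> f (PPar P Q).
Hypothesis f_choice : forall P Q, f P -> f Q -> f (PChoice P Q).
Hypothesis f_def : forall X xs P Q, guarded_in X P -> f P -> f Q -> f (PDef X xs P Q).
Hypothesis f_res : forall c d P, f P -> f (PRes c d P).
Hypothesis f_Z : forall c d, f (Z c d).
Hypothesis guarded_Z : forall X c d, guarded_in X (Z c d).

Lemma char_in_ind n u bs kc km : wf_branches n bs ->
  (forall l U V, List.In (l, (U, V)) bs -> f (kc V) /\ forall w, f (km w U)) ->
  f (char_in u bs kc km).
Proof.
move=> [ne un _] h; apply: f_in.
- by move: ne; rewrite /nilp size_map.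
- by rewrite -map_comp (@eq_map _ _ _ fst) // => -[l [U V]].
- move=> l x P /In_map [[l' [U V]] hin [_ _ <-]].
  by have [? ?] := h _ _ _ hin; apply: f_par.
Qed.

Lemma char_out_ind u bs kc km :
  (forall l U V, List.In (l, (U, V)) bs -> f (kc V) /\ forall w, f (km w U)) ->
  f (char_out Z u bs kc km).
Proof.
move=> h; rewrite /char_out; set g := fun b => _.
have {h} : forall b, List.In b bs -> f (g b).
  by move=> [l [U V]] /h [? ?]; apply: f_res; apply: f_par => //; apply: f_out; apply: f_par.
elim: bs => [|b [|b' bs] IH] //= h; first by apply: h; left.
by apply: f_choice; [apply: h; left|apply: IH => c hc; apply: h; right].
Qed.

(** A single induction for [wf_proc], [sync_proc] and [empty_queues]. *)
Lemma char_proc_ind T p n u : wf_at n T -> f (char_proc Z p n u T).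
Proof.
elim/sty_nested_ind: T p n u => [|j|T IH|bs IH|bs IH] p n u //=.
- case/andP=> gT wT; apply: f_def => //; last exact: IH.
  by apply: guarded_in_char => //; rewrite subSS subnn.
- move/wf_branchesP=> w; have h (q : bool) l U V : List.In (l, (U, V)) bs ->
    f (char_proc Z p n u V) /\ forall w, f (char_proc Z q 0 w U).
    by case: (w) => _ _ w' hin; have [? ?] := w' _ _ _ hin; have [IU IV] := IH _ _ _ hin;
       split=> [|x]; [apply: IV|apply: IU].
  by case: p h => h; [apply: char_in_ind w _|apply: char_out_ind] => l U V /h.
- move/wf_branchesP=> w; have h (q : bool) l U V : List.In (l, (U, V)) bs ->
    f (char_proc Z p n u V) /\ forall w, f (char_proc Z q 0 w U).
    by case: (w) => _ _ w' hin; have [? ?] := w' _ _ _ hin; have [IU IV] := IH _ _ _ hin;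
       split=> [|x]; [apply: IV|apply: IU].
  by case: p h => h; [apply: char_out_ind|apply: char_in_ind w _] => l U V /h.
Qed.

Lemma test_proc_ind a T : wf T -> f (test_proc Z a T).
Proof.
move=> wT; apply: f_def; first exact: guarded_in_char0.
  exact: char_proc_ind.
apply: f_par => //; apply: f_res; apply: f_par => //; apply: f_par => //.
exact: char_proc_ind.
Qed.
End Invariant.

(** * Typability of the test processes, from rules shared by the two systems *)

Section Typing.
Variable le : sty -> sty -> Prop.
Variable typ : genv -> proc -> env -> Prop.
Hypothesis sub : subtyping le.
Hypothesis t_sub : forall G P D D', typ G P D -> env_le le D D' -> typ G P D'.
Hypothesis t_nil : forall G, typ G PNil env0.
Hypothesis t_call : forall (G : genv) X u T, G.[? X] = Some [:: T] ->
  typ G (PCall X [:: u]) env0.[u <- T].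
Hypothesis t_in : forall G u (pbs : seq (nat * (nat * proc))) tbs, wf (TIn tbs) ->
  map fst pbs = map fst tbs ->
  (forall l x P, List.In (l, (x, P)) pbs -> Var x != u) ->
  (forall l x P S T, List.In (l, (x, P)) pbs -> List.In (l, (S, T)) tbs ->
     typ G P env0.[u <- T].[Var x <- S]) ->
  typ G (PIn u pbs) env0.[u <- TIn tbs].
Hypothesis t_out : forall G u l v P (D : env) S T, wf S ->
  u \notin domf D -> v \notin domf D -> u != v -> typ G P D.[u <- T] ->
  typ G (POut u l v P) D.[u <- TOut [:: (l, (S, T))]].[v <- S].
Hypothesis t_par : forall G P1 P2 D1 D2, [disjoint domf D1 & domf D2] ->
  typ G P1 D1 -> typ G P2 D2 -> typ G (PPar P1 P2) (D1 + D2).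
Hypothesis t_choice : forall G P1 P2 D, typ G P1 D -> typ G P2 D -> typ G (PChoice P1 P2) D.
Hypothesis t_def : forall (G : genv) X T P Q D, wf T ->
  typ G.[X <- [:: T]] P env0.[Var 0 <- T] -> typ G.[X <- [:: T]] Q D ->
  typ G (PDef X [:: 0] P Q) D.
Hypothesis t_new : forall G c d P D T, wf T -> Chan c \notin domf D -> Chan d \notin domf D ->
  c != d -> typ G P D.[Chan c <- T].[Chan d <- dual T] -> typ G (new Z c d P) D.

(** Each summand of the internal choice performs one output; this brings all of them to the same
    type. *)
Lemma le_single b bs : wf (TOut bs) -> List.In b bs -> le (TOut [:: b]) (TOut bs).
Proof.
move=> w hin; have [_ _ wb] := (wf_atOut 0 bs).1 w; apply: (sub_sync sub) => //.
  apply/wf_atOut; split=> // l U V [e|] //.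
  by apply: (wb l); rewrite -e.
apply: LeOut => // l U V [e|] //; subst b; have [wU wV] := wb _ _ _ hin.
by exists U, V; split=> //; apply: (sub_teq sub); apply: teq_refl.
Qed.

Lemma mem_env1 u T w : (w \in domf env0.[u <- T]) = (w == u).
Proof. by rewrite -fndSome fnd_set fnd_fmap0; case: eqP. Qed.

Lemma env_le1 u T S : le T S -> env_le le env0.[u <- T] env0.[u <- S].
Proof. by move=> h v; rewrite !fnd_set !fnd_fmap0; case: eqP. Qed.

Lemma t_par2 G P1 P2 u v T S : u != v -> typ G P1 env0.[u <- T] ->
  typ G P2 env0.[v <- S] -> typ G (PPar P1 P2) env0.[u <- T].[v <- S].
Proof.
move=> uv h1 h2.
have -> : env0.[u <- T].[v <- S] = env0.[u <- T] + env0.[v <- S] :> env.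
  apply/fmapP => w; rewrite fnd_cat !fnd_set fnd_fmap0 mem_env1.
  by case: eqP.
by apply: t_par h1 h2; apply/fdisjointP => w; rewrite !mem_env1 => /eqP ->.
Qed.

Lemma typ_char_in G u bs kc km h : wf (TIn (map_cont h bs)) ->
  (forall l U V, List.In (l, (U, V)) bs -> typ G (kc V) env0.[u <- h V] /\
     forall w, typ G (km w U) env0.[w <- U]) ->
  typ G (char_in u bs kc km) env0.[u <- TIn (map_cont h bs)].
Proof.
move=> w hb; have [_ un _] := (wf_atIn 0 _).1 w.
apply: t_in => //.
- by rewrite map_fst_cont -map_comp; apply: eq_map => -[l [U V]].
- by move=> l x P /In_map [[l' [U V]] _ [_ <- _]]; apply: fresh_varP.
move=> l x P S T /In_map [[l' [U V]] hin [el <- <-]] /In_map_cont [V' hin' <-].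
rewrite map_fst_cont in un; subst l'.
have [eU eV] := uniq_In un hin hin'; subst S V'.
have [hc hm] := hb _ _ _ hin; apply: t_par2 => //.
by rewrite eq_sym fresh_varP.
Qed.

Lemma typ_pchoice G Ps D : ~~ nilp Ps -> (forall P, List.In P Ps -> typ G P D) ->
  typ G (pchoice Ps) D.
Proof.
elim: Ps => [|P [|Q Ps] IH] //= _ h; first by apply: h; left.
by apply: t_choice; [apply: h; left|apply: IH => // R hR; apply: h; right].
Qed.

Lemma typ_char_out G u bs kc km h : wf (TOut (map_cont h bs)) ->
  (forall l U V, List.In (l, (U, V)) bs -> typ G (kc V) env0.[u <- h V] /\
     forall w, typ G (km w U) env0.[w <- dual U]) ->
  typ G (char_out Z u bs kc km) env0.[u <- TOut (map_cont h bs)].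
Proof.
move=> w hb; have [ne un wb] := (wf_atOut 0 _).1 w.
apply: typ_pchoice; first by move: ne; rewrite /nilp !size_map.
move=> _ /In_map [[l [U V]] hin <-].
have hin' : List.In (l, (U, h V)) (map_cont h bs) by apply/In_map_cont; exists V.
have [wU wV] := wb _ _ _ hin'.
apply: t_sub (env_le1 u (le_single w hin')).
have [hc hm] := hb _ _ _ hin.
have [cu du] := fresh_chanP u.
have cd : fresh_chan u != (fresh_chan u).+1 by rewrite ltn_eqF.
have ndom v : v != u -> v \notin domf env0.[u <- TOut [:: (l, (U, h V))]].
  by move=> vu; rewrite mem_env1.
apply: (t_new wU (ndom _ cu) (ndom _ du) cd).
have cd' : Chan (fresh_chan u) != Chan (fresh_chan u).+1.
  by apply/eqP => -[e]; move: cd; rewrite -e eqxx.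
have ud : u != Chan (fresh_chan u).+1 by rewrite eq_sym.
rewrite (set_env_comm _ _ _ cd') (set_env_comm _ _ _ ud).
apply: t_out => //; rewrite ?mem_env1 // 1?eq_sym //.
by rewrite -(set_env_comm _ _ _ ud); apply: t_par2.
Qed.

Lemma wf_dual_unless p T : wf T -> wf (dual_unless p T).
Proof. by case: p => // /wf_dual. Qed.

Lemma typ_char_proc T p n u (G : genv) s : wf_at n T -> size s = n -> all wf s ->
  (forall j, j < n -> G.[? n - j.+1] = Some [:: dual_unless p (nth TEnd s j)]) ->
  typ G (char_proc Z p n u T) env0.[u <- dual_unless p (msubst 0 s T)].
Proof.
elim/sty_nested_ind: T p n u G s => [|j|T IH|bs IH|bs IH] p n u G s wT sz ws hG.
- apply: (t_sub (t_nil G)) => v; rewrite fnd_set fnd_fmap0.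
  by case: eqP => //; case: p {hG} => _; apply: teq_refl.
- by rewrite /= subn0; apply: t_call; apply: hG.
- set U := msubst 0 s (TMu T).
  have wU : wf U by apply: wf_msubst => //; rewrite sz.
  apply: (t_def (wf_dual_unless p wU)); last by apply: t_call; rewrite fnd_set eqxx.
  have e : unfold1 U = msubst 0 (U :: s) T by apply: unfold1_msubst.
  (* The induction hypothesis types the body at the unfolding of [U], which is tree equal to [U]. *)
  apply: (@t_sub _ _ env0.[Var 0 <- dual_unless p (msubst 0 (U :: s) T)]); last first.
    apply: env_le1; apply: (sub_teq sub); rewrite -e.
    have t : teq (unfold1 U) U by apply: teq_unf; [apply: wf_unfold1| |apply: unf_unfold1].
    by case: (p) => //; apply: teq_dual.
  apply: IH; rewrite ?[all _ _]/= ?wU //=; first by case/andP: wT.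
    by rewrite sz.
  (* Variable 0 is bound to the new process variable n; the others keep process variables below
     n. *)
  case=> [|j] jn; first by rewrite subn1 fnd_set eqxx.
  rewrite subSS fnd_set ltn_eqF; first exact: hG.
  by rewrite ltn_subrL (leq_ltn_trans (leq0n j) jn).
- have w := (wf_atIn n bs).1 wT; have [_ _ wb] := w.
  have hm (q : bool) l U V : List.In (l, (U, V)) bs ->
      forall v, typ G (char_proc Z q 0 v U) env0.[v <- dual_unless q U].
    move=> hin v; have [wU _] := wb _ _ _ hin; rewrite -{2}(msubst_nil wU).
    exact: (IH _ _ _ hin).1.
  have hc l U V : List.In (l, (U, V)) bs ->
      typ G (char_proc Z p n u V) env0.[u <- dual_unless p (msubst 0 s V)].
    by move=> hin; have [_ wV] := wb _ _ _ hin; apply: (IH _ _ _ hin).2.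
  have wS : wf_branches 0 (map_cont (fun V => dual_unless p (msubst 0 s V)) bs).
    apply: wf_map_cont w _ => l U V hin wV; apply: wf_dual_unless.
    by apply: wf_msubst; rewrite ?sz.
  case: p wS hc {hG} => wS hc /=.
    apply: typ_char_in; first exact/wf_atIn.
    by move=> l U V hin; split; [apply: hc hin|apply: (hm true) hin].
  rewrite [X in TOut X](map_cont_comp dual); apply: typ_char_out; first exact/wf_atOut.
  by move=> l U V hin; split; [apply: hc hin|apply: (hm false) hin].
- have w := (wf_atOut n bs).1 wT; have [_ _ wb] := w.
  have hm (q : bool) l U V : List.In (l, (U, V)) bs ->
      forall v, typ G (char_proc Z q 0 v U) env0.[v <- dual_unless q U].
    move=> hin v; have [wU _] := wb _ _ _ hin; rewrite -{2}(msubst_nil wU).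
    exact: (IH _ _ _ hin).1.
  have hc l U V : List.In (l, (U, V)) bs ->
      typ G (char_proc Z p n u V) env0.[u <- dual_unless p (msubst 0 s V)].
    by move=> hin; have [_ wV] := wb _ _ _ hin; apply: (IH _ _ _ hin).2.
  have wS : wf_branches 0 (map_cont (fun V => dual_unless p (msubst 0 s V)) bs).
    apply: wf_map_cont w _ => l U V hin wV; apply: wf_dual_unless.
    by apply: wf_msubst; rewrite ?sz.
  case: p wS hc {hG} => wS hc /=.
    apply: typ_char_out; first exact/wf_atOut.
    by move=> l U V hin; split; [apply: hc hin|apply: (hm false) hin].
  rewrite [X in TIn X](map_cont_comp dual); apply: typ_char_in; first exact/wf_atIn.
  by move=> l U V hin; split; [apply: hc hin|apply: (hm true) hin].
Qed.

Lemma typ_test_proc a T : wf T -> typ genv0 (test_proc Z a T) env0.[Chan a <- T].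
Proof.
move=> wT; have hT (p : bool) G u : typ G (char_proc Z p 0 u T) env0.[u <- dual_unless p T].
  by rewrite -{2}(msubst_nil wT); apply: typ_char_proc.
have eX : genv0.[0 <- [:: T]].[? 0] = Some [:: T] by rewrite fnd_set eqxx.
apply: (t_def wT); first exact: (hT true).
rewrite -[env0.[_ <- _]]catf0; apply: t_par; first exact: fdisjointX0.
  exact: t_call.
by apply: (t_new wT) => //; apply: t_par2; [|apply: t_call|apply: (hT false)].
Qed.
End Typing.
End Positive.

(** An inert component gives the synchronous test process the same shape as the asynchronous one. *)
Definition sync_rest (_ _ : chan) : proc := PNil.

Definition async_rest (c d : chan) : proc := PPar (PQueue c d [::]) (PQueue d c [::]).

Lemma typ_s_test_proc a T : wf T -> typ_s genv0 (test_proc sync_rest a T) env0.[Chan a <- T].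
Proof.
apply: (typ_test_proc subtyping_le_s).
- exact: TsSub.
- exact: TsNil.
- move=> G X u U e; by exact: (TsCall (us := [:: u]) e).
- move=> G u pbs tbs w lab xu h; apply: (TsIn (D := env0)) => // l x P /xu ?; split=> //.
- exact: TsOut.
- exact: TsPar.
- exact: TsChoice.
- by move=> G X U P Q D wU h1 h2;
    apply: (TsDef (xs := [:: 0]) (Ts := [:: U])) h1 h2 => //=; rewrite wU.
- move=> G c d P D U wU cD dD cd h; apply: (TsRes cD dD cd (T := U)).
  by rewrite -[X in typ_s _ _ X]catf0; apply: TsPar h (TsNil _); apply: fdisjointX0.
Qed.

Lemma typ_a_test_proc a T : wf T ->
  typ_a genv0 (test_proc async_rest a T) env0.[Chan a <- T] qenv0.
Proof.
apply: (typ_test_proc (typ := fun G P D => typ_a G P D qenv0) subtyping_le_a).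
- by move=> G P D D' h l; apply: TaSub h l _ => p; rewrite fnd_fmap0.
- exact: TaNil.
- move=> G X u U e; exact: (TaCall (us := [:: u]) e).
- move=> G u pbs tbs w lab xu h; apply: (TaIn (D := env0)) => // l x P /xu ?; split=> //.
- by move=> G u l v P D U V *; apply: TaOut.
- move=> G P1 P2 D1 D2 dis h1 h2; rewrite -[qenv0]catf0.
  by apply: TaPar => //; apply: fdisjointX0.
- by move=> G P1 P2 D h1 h2; apply: TaChoice.
- by move=> G X U P Q D wU h1 h2;
    apply: (TaDef (xs := [:: 0]) (Ts := [:: U])) h1 h2 => //=; rewrite wU.
- move=> G c d P D U wU cD dD cd h.
  apply: (@TaRes _ _ _ _ D qenv0 U (dual U) [::] [::]) (RemNil _) (RemNil _) _ _ => //.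
  + by apply: teq_refl; apply: wf_dual.
  (* On the right, the first [qenv0] comes from [P] and the two singletons from the queues, in the
     order in which [async_rest] composes them. *)
  have e : qenv0.[(d, c) <- [::]].[(c, d) <- [::]] =
      qenv0 + (qenv0.[(c, d) <- [::]] + qenv0.[(d, c) <- [::]]) :> qenv.
    apply/fmapP => w; rewrite cat0f fnd_cat !fnd_set fnd_fmap0.
    rewrite -fndSome fnd_set fnd_fmap0.
    by case: (w =P (d, c)) => [->|_] //=; case: eqP => // -[e _].
  rewrite e -[X in typ_a _ _ X]catf0; apply: TaPar => //; try exact: fdisjointX0.
    exact: fdisjoint0X.
  rewrite -[X in typ_a _ _ X _]cat0f; apply: TaPar; try exact: TaQNil.
    exact: fdisjointX0.
  apply/fdisjointP => w; rewrite -!fndSome !fnd_set !fnd_fmap0.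
  case: eqP => // -> _; case: eqP => // -[e' _].
  by rewrite e' eqxx in cd.
Qed.

Theorem theorem7p1 (a : nat) (T S : sty) (wfT : wf T) (wfS : wf S) :
  (le_s T S <-> (forall P : proc, den_s a T P -> den_s a S P)) /\
  (le_a T S <-> (forall P : proc, den_a a T P -> den_a a S P)).
Proof.
have all_in (f : proc -> bool) (pbs : seq (nat * (nat * proc))) :
    (forall l x P, List.In (l, (x, P)) pbs -> f P) ->
    all (fun b => let: (_, (_, P')) := b in f P') pbs.
  by move=> h; apply/all_In => -[l [x P]] /h.
have wf_test Z : (forall c d, wf_proc (Z c d)) -> (forall X c d, guarded_in X (Z c d)) ->
    wf_proc (test_proc Z a T).
  move=> wZ gZ; apply: test_proc_ind => //=.
  - by move=> _ pbs -> -> /all_in ->.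
  - by move=> P Q -> ->.
  - by move=> P Q -> ->.
  - by move=> X _ P Q -> -> ->.
split; split=> [lTS P|h].
- case=> wP sP tP; split=> //; apply: TsSub tP _; exact: env_le1.
- have [|_ _ t] := h (test_proc sync_rest a T).
    split; [exact: wf_test| |exact: typ_s_test_proc].
    apply: test_proc_ind => //=.
    + by move=> _ pbs _ _ /all_in.
    + by move=> P Q -> ->.
    + by move=> P Q -> ->.
    + by move=> X _ P Q _ -> ->.
  apply: (test_procP (Z := sync_rest) (a := a) _ subtyping_le_s wfT) => //.
  exact: (typ_s_gtyp t gwf0).1.
- case=> wP tP; split=> //; apply: TaSub tP (env_le1 _ lTS) _ => p.
  by rewrite fnd_fmap0.
- have [|_ t] := h (test_proc async_rest a T).
    by split; [apply: wf_test|apply: typ_a_test_proc].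
  apply: (test_procP (Z := async_rest) (a := a) _ subtyping_le_a wfT) => //.
  apply: (typ_a_gtyp t gwf0 _).1.1.
  apply: test_proc_ind => //=.
  + by move=> _ pbs _ _ /all_in.
  + by move=> P Q -> ->.
  + by move=> P Q -> ->.
  + by move=> X _ P Q _ -> ->.
Qed.
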